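(* Let $n\ge2$, $k\in\{1,\dots,n-1\}$. The rational map $\Theta_{n-k}^{-1}\circ\mathrm{PR}\circ\Theta_{n-k}:\mathbb T_k\to\mathbb T_k$ has subtraction-free component functions; let $\widehat{\mathrm{PR}}=\mathrm{Trop}(\Theta_{n-k}^{-1}\circ\mathrm{PR}\circ\Theta_{n-k}):\widetilde{\mathbb T}_k\to\widetilde{\mathbb T}_k$. Then for every $k$-rectangle $b$, $\widehat{\mathrm{PR}}(b)=\widetilde{\mathrm{pr}}(b)$, where $\widetilde{\mathrm{pr}}$ is promotion of the corresponding rectangular tableau.
   Context: Notation: $[i,j]=\{m\in\mathbb Z:i\le m\le j\}$, $[n]=[1,n]$; $E_{ij}$ are $n\times n$ matrix units. For $r\in[n-1]$, $\mathcal X_r=\mathrm{Gr}(r,n)\times\mathbb C^\times$, where points of $\mathrm{Gr}(r,n)$ are column spans of full-rank $n\times r$ matrices, and $P_J(M)$ ($J\subset[n]$, $|J|=r$) is the minor on rows $J$. Cyclic shift: $\mathrm{PR}:\mathcal X_{n-k}\to\mathcal X_{n-k}$, $\mathrm{PR}(M,t)=(M',t)$, where a matrix for $M'$ is obtained from one for $M$ by moving every row down by one position cyclically (row $n$ becomes row $1$) and multiplying the new first row by $(-1)^{n-k-1}t$. Gelfand–Tsetlin parametrization: for $m\in[n-1]$ let $R_m=\{(i,j):1\le i\le m,\ i\le j\le i+n-m-1\}$ and $\mathbb T_m=(\mathbb C^\times)^{R_m}\times\mathbb C^\times$ with points $(X_{ij},t)$. Let $x_{-i}(c)=cE_{ii}+c^{-1}E_{i+1,i+1}+E_{i+1,i}+\sum_{j\ne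 i,i+1}E_{jj}$ ($i\in[n-1]$), $t_i(c)=cE_{ii}+\sum_{j\ne i}E_{jj}$ ($i\in[n]$), and $M_{[i,j]}(c_i,\dots,c_j)=x_{-i}(c_i)x_{-(i+1)}(c_{i+1})\cdots x_{-(j-1)}(c_{j-1})t_j(c_j)$. Put $\Phi_m(X_{ij},t)=\prod_{i=m}^{1}M_{[i,i+n-m]}(X_{ii},X_{i,i+1},\dots,X_{i,i+n-m-1},t)$ (factors from left to right in decreasing order of $i$), and $\Theta_{n-m}:\mathbb T_m\to\mathcal X_{n-m}$, $\Theta_{n-m}(X_{ij},t)=(M,t)$ with $M$ the span of the first $n-m$ columns of $\Phi_m(X_{ij},t)$. This is a birational isomorphism. Tropicalization: a subtraction-free rational function is a nonzero rational function that can be written as a ratio of polynomials with nonnegative integer coefficients; its tropicalization $\mathrm{Trop}$ is the piecewise-linear function on integer points obtained by evaluating any such expression in the tropical semifield, i.e. replacing $+$ by $\min$, $\times$ by $+$, $\div$ by $-$, and positive integer constants by $0$ (this is independent of the expression); variables $X_{ij}$ are replaced by $B_{ij}$ and $t$ by $L$. Tuples are tropicalized componentwise. $k$-rectangles: $\widetilde{\mathbb T}_k=\mathbb Z^{R_k}\times\mathbb Z$ with points $b=(B_{ij},L)$. Form the triangular array $(A_{ij})_{1\le i\le j\le n}$ with $A_{ij}=B_{ij}$ for $(i,j)\in R_k$ and $A_{ij}=L$ for $j>i+n-k-1$. Then $b$ is a $k$-rectangle if all $A_{ij}\ge0$ and $A_{i,j+1}\ge A_{ij}\ge A_{i+1,j+1}$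 for all $1\le i\le j\le n-1$. The $k$-rectangles with given $L$ are in bijection with semistandard Young tableaux of rectangular shape with $k$ rows and $L$ columns and entries in $[n]$ (rows weakly increasing, columns strictly increasing), via $B_{ij}=$ number of entries $\le j$ in row $i$; maps on tableaux are transported to $k$-rectangles via this bijection. Promotion: for $r\in[n-1]$, the Bender–Knuth involution $\widetilde\sigma_r$ acts on a tableau row by row: in a given row, let $\alpha$ be the number of entries $r$ not directly above an entry $r+1$, and $\beta$ the number of entries $r+1$ not directly below an entry $r$; these form a consecutive subword $r^\alpha(r+1)^\beta$, which is replaced by $r^\beta(r+1)^\alpha$. Promotion is $\widetilde{\mathrm{pr}}=\widetilde\sigma_1\widetilde\sigma_2\cdots\widetilde\sigma_{n-1}$ (so $\widetilde\sigma_{n-1}$ is applied first). *)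

(* Defs.v *)
From mathcomp Require Import all_boot all_order all_algebra.
From mathcomp Require Import boolp classical_sets reals complex mpoly.

Set Implicit Arguments.
Unset Strict Implicit.
Unset Printing Implicit Defensive.

Import Order.TTheory GRing.Theory Num.Theory.
Local Open Scope ring_scope.

(* R_m; indices are the 1-based ones of the text *)
Definition Rset (n m : nat) : seq (nat * nat) :=
  [seq (i, j) | i <- iota 1 m, j <- iota i (n - m)].

(* Some (i, j) is the coordinate X_ij (or B_ij), None is t (or L). *)
Definition coords (n m : nat) : finType := option (seq_sub (Rset n m)).

(* The array (A_ij) extending the coordinates: X_ij on R_m, t to the right of
   R_m (j > i + n - m - 1), and 0 below row m. *)
Definition array (V : nmodType) (n m : nat) (x : coords n m -> V) (i j : nat) : V :=
  if insub (i, j) is Some v then x (Some v)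
  else if (i + (n - m) <= j)%N then x None else 0.

Section Varieties.
Variable C : fieldType.

Definition Eunit (n i j : nat) : 'M[C]_n :=
  \matrix_(a, b) ((a.+1 == i) && (b.+1 == j))%:R.

Definition xneg (n i : nat) (c : C) : 'M[C]_n :=
  c *: Eunit n i i + c^-1 *: Eunit n i.+1 i.+1 + Eunit n i.+1 i
  + \sum_(1 <= j < n.+1 | (j != i) && (j != i.+1)) Eunit n j j.

Definition tdiag (n i : nat) (c : C) : 'M[C]_n :=
  c *: Eunit n i i + \sum_(1 <= j < n.+1 | j != i) Eunit n j j.

Definition Mseg (n i j : nat) (c : nat -> C) : 'M[C]_n :=
  (\prod_(i <= l < j) xneg n l (c l)) * tdiag n j (c j).

(* array x i (i + n - m) is t *)
Definition Phi (n m : nat) (x : coords n m -> C) : 'M[C]_n :=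
  \prod_(i <- rev (iota 1 m)) Mseg n i (i + (n - m)) (array x i).

Definition torus (n m : nat) : set (coords n m -> C) :=
  [set x | forall v, x v != 0].

Definition colspan (n r : nat) (A : 'M[C]_(n, r)) : {vspace 'cV[C]_n} :=
  <<[seq col j A | j : 'I_r]>>%VS.

(* Gr(r, n) x C^* is the set of the (V, t) with \dim V = r and t != 0. *)
Definition Theta (n m : nat) (x : coords n m -> C) : {vspace 'cV[C]_n} * C :=
  (colspan (colsub (widen_ord (leq_subr m n)) (Phi x)), x None).

(* The set-theoretic inverse of Theta on the torus: a fibre, which is a
   singleton over a dense open subset since Theta is birational. *)
Definition Theta_inv (n m : nat) (y : {vspace 'cV[C]_n} * C) :
  set (coords n m -> C) := [set x | torus x /\ Theta x = y]%classic.

Definition basis_mx (n : nat) (V : {vspace 'cV[C]_n}) : 'M[C]_(n, \dim V) :=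
  \matrix_(i, j) tnth (vbasis V) j i ord0.

(* ord_pred is the cyclic predecessor, so row 0 of the result comes from the
   last row of A. *)
Definition shift_rows (n p r : nat) (t : C) (A : 'M[C]_(n, p)) : 'M[C]_(n, p) :=
  \matrix_(i, j)
    ((if i == 0%N :> nat then (-1) ^+ r.-1 * t else 1) * A (ord_pred i) j).

(* The action on subspaces does not depend on the matrix chosen for V. *)
Definition PR (n r : nat) (y : {vspace 'cV[C]_n} * C) : {vspace 'cV[C]_n} * C :=
  (colspan (shift_rows r y.2 (basis_mx y.1)), y.2).

Definition ratfun (n m : nat) : Type := {fraction {mpoly C[#|coords n m|]}}.

Definition peval (n m : nat) (p : {mpoly C[#|coords n m|]})
  (x : coords n m -> C) : C := p.@[fun i => x (enum_val i)].

(* f is regular at x, with value a *)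
Definition has_value (n m : nat) (f : ratfun n m) (x : coords n m -> C) (a : C) :=
  exists p q : {mpoly C[#|coords n m|]},
    [/\ f = tofrac p / tofrac q, peval q x != 0 & a = peval p x / peval q x].

(* The tuple F of rational functions is the rational map defined by the
   multivalued map phi: on a dense open subset {h != 0} of the torus, F is
   regular and phi takes the single value given by F. *)
Definition is_rational_map (n m : nat)
    (phi : (coords n m -> C) -> set (coords n m -> C))
    (F : coords n m -> ratfun n m) : Prop :=
  exists2 h : {mpoly C[#|coords n m|]}, h != 0 &
    forall x, torus x -> peval h x != 0 ->
      exists2 y, (forall v, has_value (F v) x (y v)) & phi x = [set y]%classic.

End Varieties.

Definition nonneg_poly (N : nat) (p : {mpoly int[N]}) : Prop :=
  forall mo, 0 <= p@_mo.

Definition sf_expr (C : fieldType) (n m : nat) (f : ratfun C n m)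
    (pq : {mpoly int[#|coords n m|]} * {mpoly int[#|coords n m|]}) : Prop :=
  [/\ nonneg_poly pq.1 /\ nonneg_poly pq.2, pq.2 != 0 &
      f = tofrac (map_mpoly (intr : int -> C) pq.1)
          / tofrac (map_mpoly (intr : int -> C) pq.2)].

Definition subtraction_free (C : fieldType) (n m : nat) (f : ratfun C n m) : Prop :=
  f != 0 /\ exists pq, sf_expr f pq.

(* Meaningful for p != 0 with nonnegative coefficients, which tropicalize to 0;
   the seed of the min is itself one of the terms. *)
Definition trop_poly (n m : nat) (p : {mpoly int[#|coords n m|]})
    (b : coords n m -> int) : int :=
  let s := [seq \sum_i b (enum_val i) *+ mo i | mo : 'X_{1..#|coords n m|} <- msupp p] in
  \big[Num.min/head 0 s]_(w <- s) w.

(* The value does not depend on the expression pq of f picked by xget. *)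
Definition Trop (C : fieldType) (n m : nat) (f : ratfun C n m)
    (b : coords n m -> int) : int :=
  let pq := xget (1, 1) [set pq | sf_expr f pq]%classic in
  trop_poly pq.1 b - trop_poly pq.2 b.

Definition k_rectangle (n k : nat) (b : coords n k -> int) : Prop :=
  (forall i j, (1 <= i <= j)%N -> (j <= n)%N -> 0 <= array b i j) /\
  (forall i j, (1 <= i <= j)%N -> (j <= n.-1)%N ->
     array b i.+1 j.+1 <= array b i j <= array b i j.+1).

(* Row i of the text is row i - 1 of the matrix; entries are in [1, n]. *)
Definition ssyt (n k L : nat) (T : 'M[nat]_(k, L)) : Prop :=
  [/\ forall i c, (1 <= T i c <= n)%N,
      forall i (c c' : 'I_L), (c <= c')%N -> (T i c <= T i c')%N
    & forall (i i' : 'I_k) c, (i < i')%N -> (T i c < T i' c)%N].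

Definition rect_of_tab (n k L : nat) (T : 'M[nat]_(k, L)) : coords n k -> int :=
  fun v => if v is Some ij then
    (\sum_(a < k | a.+1 == (val ij).1) #|[set c | (T a c <= (val ij).2)%N]|)%:Z
  else L%:Z.

Definition tab_of_rect (n k : nat) (b : coords n k -> int) : 'M[nat]_(k, `|b None|) :=
  xget (const_mx 0%N) [set T | ssyt n T /\ rect_of_tab T = b]%classic.

Section BenderKnuth.
Variables (k L r : nat) (T : 'M[nat]_(k, L)).

Definition free_lo (i : 'I_k) (c : 'I_L) : bool :=
  (T i c == r) && ~~ [exists i' : 'I_k, (i' == i.+1 :> nat) && (T i' c == r.+1)].

Definition free_hi (i : 'I_k) (c : 'I_L) : bool :=
  (T i c == r.+1) && ~~ [exists i' : 'I_k, (i == i'.+1 :> nat) && (T i' c == r)].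

(* Among the free cells of row i, read from left to right, the first beta
   receive r and the remaining alpha receive r + 1. *)
Definition bender_knuth : 'M[nat]_(k, L) :=
  \matrix_(i, c)
    if free_lo i c || free_hi i c then
      if (#|[set d : 'I_L | (d < c)%N && (free_lo i d || free_hi i d)]|
          < #|[set d | free_hi i d]|)%N
      then r else r.+1
    else T i c.

End BenderKnuth.

Definition promotion (n k L : nat) (T : 'M[nat]_(k, L)) : 'M[nat]_(k, L) :=
  foldr (fun r T' => bender_knuth r T') T (iota 1 n.-1).

Definition pr_rect (n k : nat) (b : coords n k -> int) : coords n k -> int :=
  rect_of_tab (promotion n (tab_of_rect b)).

(* Main.v *)
(* Write r = n - k.  Each factor M_[i,i+r] is lower bidiagonal, so a vector of
   Theta(X) is produced by feeding u in <e_1, ..., e_r> through k two-term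
   recursions p_l := p_(l-1) + (X_il / X_i(l-1)) p_l.  Let Y be obtained from X by
   the birational toggles, column n - 1 first:
     Y_ij X_ij (1/X_i(j-1) + 1/Y_(i+1)(j+1)) = X_(i-1)(j-1) + Y_i(j+1),
   where terms outside the array, and the term t on the right edge of a row
   i >= 2, are dropped.  With alpha_i(j+1) := X_ij (1/X_i(j-1) + 1/Y_(i+1)(j+1)),
   the state of the Y-recursion after row i is p_(l-2) + alpha_il p_(l-1), p being
   the state of the X-recursion after row i - 1; hence the Y-recursion outputs the
   cyclically shifted vector and Theta(Y) = PR(Theta(X)).  The parameters X_ij can
   be peeled off Theta(X) row by row, so Theta is injective on the torus and Y is
   the conjugated map.  It is visibly subtraction-free, and on Gelfand-Tsetlin
   patterns the tropical toggles of a column are the Bender-Knuth involution,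
   because the free cells of row i form the interval from
   max(A_i(c-1), A_(i+1)(c+1)) to min(A_i(c+1), A_(i-1)(c-1)). *)

Require Import Defs.
From mathcomp Require Import all_boot all_order all_algebra.
From mathcomp Require Import boolp classical_sets reals complex mpoly.
From mathcomp Require Import zify ring.

Set Implicit Arguments.
Unset Strict Implicit.
Unset Printing Implicit Defensive.

Import Order.TTheory GRing.Theory Num.Theory.
Local Open Scope ring_scope.

(** * Toggles on triangular arrays *)

Section Toggles.
Variables (n k : nat).

Definition in_R (i j : nat) : bool :=
  [&& (1 <= i)%N, (i <= k)%N, (i <= j)%N & (j < i + (n - k))%N].

Section Ops.
Variables (V : Type) (add mul : V -> V -> V) (inv : V -> V) (one : V).

(** [X] holds old values and [Y] new ones; a single toggle takes both to be the current array. Terms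
    outside the array are dropped by cases because the same formula must serve a field and
    $(\min,+)$ on integers, where [add] has no neutral element; an empty sum in [tog_low] is
    therefore replaced by [one]. *)
Definition tog_up (X Y : nat -> nat -> V) (i j : nat) : V :=
  if i == 1%N then Y i j.+1
  else if j.+1 == (i + (n - k))%N then X i.-1 j.-1
  else add (X i.-1 j.-1) (Y i j.+1).

Definition tog_low (X Y : nat -> nat -> V) (i j : nat) : V :=
  if j == i then (if i == k then one else inv (Y i.+1 j.+1))
  else if i == k then inv (X i j.-1)
  else add (inv (X i j.-1)) (inv (Y i.+1 j.+1)).

Definition toggle (c : nat) (A : nat -> nat -> V) (i j : nat) : V :=
  if (j == c) && in_R i j
  then mul (tog_up A A i j) (inv (mul (A i j) (tog_low A A i j)))
  else A i j.

Definition prom (A : nat -> nat -> V) : nat -> nat -> V :=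
  foldr toggle A (iota 1 n.-1).

Lemma foldr_toggle_out s A i j : j \notin s -> foldr toggle A s i j = A i j.
Proof.
elim: s => //= c s IH; rewrite inE negb_or => /andP[/negbTE jc js].
by rewrite /toggle jc /= IH.
Qed.

Lemma prom_out A i j : ~~ in_R i j -> prom A i j = A i j.
Proof.
move=> H; rewrite /prom; elim: (iota _ _) => //= c s IH.
by rewrite /toggle (negbTE H) andbF.
Qed.

(** When column $j$ is toggled, the columns on its right are final and those on its left untouched,
    so it reads column $j+1$ of the result and column $j-1$ of the input. The composition of toggles
    thus becomes one implicit system relating input and output. *)
Lemma prom_eq A i j : (0 < k <= n)%N -> in_R i j ->
  prom A i j = mul (tog_up A (prom A) i j)
                   (inv (mul (A i j) (tog_low A (prom A) i j))).
Proof.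
move=> hk hij; have : (1 <= j <= n.-1)%N by move: hij; rewrite /in_R; lia.
move=> hj.
(* The array just before column $j$ is toggled. *)
pose B := foldr toggle A (iota j.+1 (n.-1 - j)).
have pE c l : prom A c l = foldr toggle (toggle j B) (iota 1 j.-1) c l.
  rewrite /prom; have -> : n.-1 = (j.-1 + (n.-1 - j).+1)%N by lia.
  by rewrite iotaD foldr_cat /= add1n prednK //; lia.
have pj c : prom A c j = toggle j B c j.
  by rewrite pE foldr_toggle_out // mem_iota; lia.
have pj1 c : prom A c j.+1 = B c j.+1.
  rewrite pE foldr_toggle_out; last by rewrite mem_iota; lia.
  by rewrite /toggle; have /negbTE-> : j.+1 != j by lia.
have Bo c l : (l <= j)%N -> B c l = A c l.
  by move=> hl; rewrite /B foldr_toggle_out // mem_iota; lia.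
rewrite pj /toggle eqxx hij /= Bo //.
have upE : tog_up B B i j = tog_up A (prom A) i j.
  by rewrite /tog_up !pj1 (Bo _ j.-1) // leq_pred.
have lowE : tog_low B B i j = tog_low A (prom A) i j.
  by rewrite /tog_low !pj1 (Bo _ j.-1) // leq_pred.
by rewrite upE lowE.
Qed.

End Ops.

(* The extra cell is the only one carrying t that the toggles read. *)
Definition tog_dom (i j : nat) : bool :=
  in_R i j || ((i == 1%N) && (j == 1 + (n - k))%N).

Section Param.
Variables (V : Type) (add : V -> V -> V) (inv : V -> V) (one : V).
Variables (W : Type) (addw : W -> W -> W) (invw : W -> W) (onew : W).
Variable Rel : V -> W -> Prop.
Hypothesis RD : forall a b a' b', Rel a a' -> Rel b b' ->
  Rel (add a b) (addw a' b').
Hypothesis R1 : Rel one onew.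
Variables (X Y : nat -> nat -> V) (X' Y' : nat -> nat -> W).
Hypothesis RX : forall i j, tog_dom i j -> Rel (X i j) (X' i j).
Hypothesis RY : forall i j, tog_dom i j -> Rel (Y i j) (Y' i j).

Lemma tog_up_rel i j : in_R i j -> Rel (tog_up add X Y i j) (tog_up addw X' Y' i j).
Proof.
rewrite /tog_up => H; case: eqP => [i1|i1].
  by apply: RY; move: H; rewrite /tog_dom /in_R; lia.
case: eqP => [j1|j1]; first by apply: RX; move: H; rewrite /tog_dom /in_R; lia.
by apply: RD; [apply: RX | apply: RY]; move: H; rewrite /tog_dom /in_R; lia.
Qed.

(** Inverses are assumed related only at entries that are read, since [has_value] is compatible with
    inversion only at nonzero values. *)
Hypothesis RXV : forall i j, tog_dom i j -> Rel (inv (X i j)) (invw (X' i j)).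
Hypothesis RYV : forall i j, tog_dom i j -> Rel (inv (Y i j)) (invw (Y' i j)).

Lemma tog_low_rel i j : in_R i j ->
  Rel (tog_low add inv one X Y i j) (tog_low addw invw onew X' Y' i j).
Proof.
rewrite /tog_low => H; case: eqP => [i1|i1]; case: eqP => [j1|j1] //.
- by apply: RYV; move: H; rewrite /tog_dom /in_R; lia.
- by apply: RXV; move: H; rewrite /tog_dom /in_R; lia.
- by apply: RD; [apply: RXV | apply: RYV];
    move: H; rewrite /tog_dom /in_R; lia.
Qed.

End Param.

Section ParamProm.
Variables (V : Type) (add mul : V -> V -> V) (inv : V -> V) (one : V).
Variables (W : Type) (addw mulw : W -> W -> W) (invw : W -> W) (onew : W).
Variable Rel : V -> W -> Prop.
Hypothesis RD : forall a b a' b', Rel a a' -> Rel b b' ->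
  Rel (add a b) (addw a' b').
Hypothesis RM : forall a b a' b', Rel a a' -> Rel b b' ->
  Rel (mul a b) (mulw a' b').
Hypothesis RV : forall a a', Rel a a' -> Rel (inv a) (invw a').
Hypothesis R1 : Rel one onew.

Lemma prom_rel (X : nat -> nat -> V) (X' : nat -> nat -> W) :
  (forall i j, tog_dom i j -> Rel (X i j) (X' i j)) ->
  forall i j, tog_dom i j ->
    Rel (prom add mul inv one X i j) (prom addw mulw invw onew X' i j).
Proof.
move=> H; rewrite /prom; elim: (iota _ _) => //= c s IH i j hij.
rewrite /toggle; case: ifP => [/andP[_ h]|_]; last exact: IH.
apply: RM; first exact: tog_up_rel.
apply: RV; apply: RM; first exact: IH.
by apply: tog_low_rel => // i' j' h'; apply/RV/IH.
Qed.

End ParamProm.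
End Toggles.

(** * The bidiagonal factors of Phi *)

Section Bidiagonal.
Variable C : fieldType.
Implicit Types (c p u : nat -> C) (X Y : nat -> nat -> C).

(* Coordinates of vectors are numbered from 1, as in the text. *)
Definition vec n (p : nat -> C) : 'cV[C]_n := \col_(a < n) p a.+1.

Lemma Eunit_vec n i j p : (1 <= j <= n)%N ->
  Eunit C n i j *m vec n p = vec n (fun l => (l == i)%:R * p j).
Proof.
move=> hj; apply/colP => a; rewrite !mxE.
have hj' : (j.-1 < n)%N by lia.
rewrite (bigD1 (Ordinal hj')) //= !mxE /= prednK; last by lia.
rewrite eqxx andbT big1 ?addr0 // => b hb; rewrite !mxE.
have /negbTE-> : b.+1 != j.
  by apply: contraNneq hb => e; apply/eqP/val_inj; rewrite /= -e.
by rewrite andbF mul0r.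
Qed.

Lemma sum_Eunit_vec n (P : pred nat) p :
  (\sum_(1 <= j < n.+1 | P j) Eunit C n j j) *m vec n p =
  vec n (fun l => if P l then p l else 0).
Proof.
rewrite mulmx_suml; apply/colP => a; rewrite summxE mxE.
have ha := ltn_ord a.
have hE j : (1 <= j < n.+1)%N ->
    (Eunit C n j j *m vec n p) a ord0 = (a.+1 == j)%:R * p j.
  by move=> hj; rewrite Eunit_vec ?mxE //; lia.
rewrite big_mkcond (bigD1_seq a.+1) ?iota_uniq ?mem_index_iota ?ltnS //=.
rewrite big_nat_cond big1 => [|j /andP[hj hja]].
  by rewrite addr0; case: ifP => // _; rewrite hE ?eqxx ?mul1r //; lia.
by case: ifP => // _; rewrite hE // eq_sym (negbTE hja) mul0r.
Qed.

Lemma tdiag_vec n i (c : C) p : (1 <= i <= n)%N ->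
  tdiag n i c *m vec n p = vec n (fun l => if l == i then c * p i else p l).
Proof.
move=> hi; rewrite /tdiag mulmxDl -scalemxAl Eunit_vec // sum_Eunit_vec.
apply/colP => a; rewrite !mxE; case: eqP => [->|_] /=.
  by rewrite mul1r addr0.
by rewrite mul0r mulr0 add0r.
Qed.

Lemma xneg_vec n i (c : C) p : (1 <= i < n)%N ->
  xneg n i c *m vec n p = vec n (fun l =>
    if l == i then c * p i else if l == i.+1 then p i + c^-1 * p i.+1 else p l).
Proof.
move=> hi; rewrite /xneg !mulmxDl -!scalemxAl !Eunit_vec ?sum_Eunit_vec; try lia.
apply/colP => a; rewrite !mxE; case: (a.+1 =P i) => [->|_] /=.
  have /negbTE-> : i != i.+1 by lia.
  by rewrite !(mul1r, mul0r, mulr0, addr0).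
case: (a.+1 =P i.+1) => [->|_] /=.
  by rewrite !(mul1r, mul0r, mulr0, addr0, add0r) addrC.
by rewrite !(mul1r, mul0r, mulr0, addr0, add0r).
Qed.

Definition bidiag r i c p (l : nat) : C :=
  if l == i then c i * p i
  else if (i < l <= i + r)%N then p l.-1 + c l / c l.-1 * p l else p l.

(** Induction through $M_{[i,i+r]}=x_{-i}(c_i)M_{[i+1,i+r]}$: the inner product leaves
    $c_{i+1}p_{i+1}$ at position $i+1$, which $x_{-i}(c_i)$ turns into
    $p_i+(c_{i+1}/c_i)p_{i+1}$. *)
Lemma Mseg_vec n r i c p : (1 <= i)%N -> (i + r <= n)%N ->
  Mseg n i (i + r) c *m vec n p = vec n (bidiag r i c p).
Proof.
rewrite /Mseg; elim: r i => [|r IH] i hi hn.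
  rewrite addn0 big_geq // mul1r tdiag_vec; last by lia.
  apply/colP => a; rewrite !mxE /bidiag addn0; case: eqP => // _.
  by case: ifP => //; lia.
rewrite big_ltn; last by lia.
rewrite -mulrA -mulmxE -mulmxA addnS -addSn IH; try lia.
rewrite xneg_vec; last by lia.
apply/colP => a; rewrite !mxE /bidiag.
case: (a.+1 =P i) => [_|ne] /=.
  have /negbTE-> : i != i.+1 by lia.
  by case: ifP => //; lia.
case: (a.+1 =P i.+1) => [[->]|ne'].
  rewrite ?eqxx; have /negbTE-> : i != i.+1 by lia.
  by repeat (case: ifP; try lia; move=> _); rewrite /= mulrA [_^-1 * _]mulrC.
by do 2 case: ifP => //; lia.
Qed.

(* State after the first m factors (rows 1, ..., m) of Phi have acted on u. *)
Fixpoint flow r X (u : nat -> C) (m : nat) : nat -> C :=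
  if m is m'.+1 then bidiag r m (X m) (flow r X u m') else u.

Lemma flowS r X u m : flow r X u m.+1 = bidiag r m.+1 (X m.+1) (flow r X u m).
Proof. by []. Qed.

Lemma prod_Mseg_vec n r X u m : (m + r <= n)%N ->
  (\prod_(i <- rev (iota 1 m)) Mseg n i (i + r) (X i)) *m vec n u =
  vec n (flow r X u m).
Proof.
elim: m => [|m IH] hm; first by rewrite big_nil mul1mx.
rewrite -[in iota _ _](addn1 m) iotaD rev_cat big_cat big_seq1 /= add1n.
by rewrite -mulmxE -mulmxA IH ?Mseg_vec //; lia.
Qed.

Lemma colspanP n m (A : 'M[C]_(n, m)) w :
  reflect (exists v, w = A *m v) (w \in colspan A).
Proof.
have mulE (v : 'cV_m) : A *m v = \sum_j v j ord0 *: col j A.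
  apply/colP => i; rewrite mxE summxE; apply: eq_bigr => j _.
  by rewrite !mxE mulrC.
rewrite /colspan span_def big_image /=.
apply: (iffP memv_sumP) => [[vs hvs ->]|[v ->]].
  have /fin_all_exists[f hf] : forall j, exists a, vs j = a *: col j A.
    by move=> j; have /vlineP[a ->] := hvs j isT; exists a.
  exists (\col_j f j); rewrite mulE; apply: eq_bigr => j _.
  by rewrite mxE hf.
exists (fun j => v j ord0 *: col j A) => [j _|]; last exact: mulE.
by rewrite memvZ // memv_line.
Qed.

Lemma colspan_basis_mx n (V : {vspace 'cV[C]_n}) : colspan (basis_mx V) = V.
Proof.
rewrite /colspan -[RHS](span_basis (vbasisP V)); have colE j : col j (basis_mx V) = tnth (vbasis V) j.
  by apply/colP => i; rewrite !mxE.
apply: eq_span => w; apply/idP/idP => [/mapP[j _ ->]|/tnthP[j ->]].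
  by rewrite colE mem_tnth.
by rewrite -colE; apply: map_f; rewrite mem_enum.
Qed.

Lemma shift_rows_mul n m (q : nat) r t (A : 'M[C]_(n, m)) (B : 'M[C]_(m, q)) :
  shift_rows r t A *m B = shift_rows r t (A *m B).
Proof.
apply/matrixP => i j; rewrite !mxE mulr_sumr; apply: eq_bigr => l _.
by rewrite !mxE mulrA.
Qed.

Lemma mem_PR n r (V : {vspace 'cV[C]_n}) t w :
  reflect (exists2 v, v \in V & w = shift_rows r t v) (w \in (PR r (V, t)).1).
Proof.
apply: (iffP (colspanP _ _)) => [[v ->]|[v hv ->]].
  exists (basis_mx V *m v); last by rewrite shift_rows_mul.
  by rewrite -{3}(colspan_basis_mx V); apply/colspanP; exists v.
move: hv; rewrite -{1}(colspan_basis_mx V) => /colspanP[u ->].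
by exists u; rewrite shift_rows_mul.
Qed.

Lemma shift_rows_vec n r t p :
  shift_rows r t (vec n p) =
  vec n (fun l => if l == 1%N then (-1) ^+ r.-1 * t * p n else p l.-1).
Proof.
apply/colP => a; rewrite !mxE; have ha := ltn_ord a.
rewrite eqSS; case: eqP => [a0|a0] /=.
  by congr (_ * p _); rewrite a0 add0n modn_small prednK; lia.
rewrite mul1r; congr (p _).
have -> : ((a + n).-1 = a.-1 + n)%N by lia.
by rewrite modnDr modn_small; lia.
Qed.

Lemma vec_eq n p q : vec n p = vec n q -> forall l, (1 <= l <= n)%N -> p l = q l.
Proof.
move=> /colP e l hl; have hl' : (l.-1 < n)%N by lia.
by have := e (Ordinal hl'); rewrite !mxE /= prednK //; lia.
Qed.

Lemma eq_vec n p q : (forall l, (1 <= l <= n)%N -> p l = q l) -> vec n p = vec n q.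
Proof. by move=> e; apply/colP => a; rewrite !mxE e /= ?ltn_ord. Qed.

Definition supp_in m (u : nat -> C) := forall l, ~~ (1 <= l <= m)%N -> u l = 0.

(** Keeping the first $n-k$ columns amounts to feeding in vectors supported on $[1,n-k]$; this
    replaces the matrix by the recursion [flow]. *)
Lemma mem_Theta n k (x : coords n k -> C) w : (k <= n)%N ->
  w \in (Theta x).1 <->
  exists2 u, supp_in (n - k) u & w = vec n (flow (n - k) (array x) u k).
Proof.
move=> hk; set r := (n - k)%N; have hr : (k + r <= n)%N by rewrite /r; lia.
pose f := @widen_ord r n (leq_subr k n).
have subE (A : 'M[C]_n) (v : 'cV[C]_r) u : supp_in r u ->
   (forall j, v j ord0 = u j.+1) -> colsub f A *m v = A *m vec n u.
  move=> hu hv; rewrite -{1}[A]mulmx1 -mulmx_colsub -mulmxA; congr (_ *m _).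
  apply/colP => i; rewrite !mxE; case: (ltnP i r) => hi.
    rewrite (bigD1 (Ordinal hi)) //= !mxE -val_eqE eqxx mul1r hv big1 ?addr0 //.
    move=> j; rewrite !mxE -!val_eqE /= eq_sym => /negbTE->.
    by rewrite mul0r.
  rewrite big1 ?hu //; first by lia.
  move=> j _; rewrite !mxE -val_eqE /=; have := ltn_ord j.
  by case: eqP; rewrite ?mul0r //; lia.
have vecE := prod_Mseg_vec (array x) _ hr.
split=> [/colspanP[v ->]|[u hu ->]].
  (* $0$ and $1$ have the same truncated predecessor, so $l=0$ is excluded separately. *)
  exists (fun l => if insub l.-1 is Some j then
     (if l == 0%N then 0 else v j ord0) else 0).
    move=> [|l] hl /=; first by case: insubP.
    by rewrite insubN //; lia.
  by rewrite -vecE; apply: subE => [l hl|j] /=; rewrite ?valK //;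
    case: l hl => [|l] hl /=; [case: insubP | rewrite insubN //; lia].
apply/colspanP; exists (\col_j u j.+1); rewrite -vecE.
by apply/esym/subE => // j; rewrite mxE.
Qed.

End Bidiagonal.

Arguments flow : simpl never.

(** * The two-term recursions *)

Section Flow.
Variable C : fieldType.
Implicit Types (u : nat -> C) (X Y : nat -> nat -> C).

Lemma flow_supp r X u m i l : supp_in m u -> (m + i < l)%N -> flow r X u i l = 0.
Proof.
move=> hu; elim: i l => [|i IH] l hl; first by apply: hu; lia.
rewrite flowS /bidiag; case: eqP => [|_]; first by lia.
by case: ifP => _; rewrite !IH ?mulr0 ?addr0 //; lia.
Qed.

(** The coefficient of $p_{l-1}$ in the recursion is $1$, so each row moves the top coordinate up by
    one position without changing its value. *)
Lemma flow_top r X u m i : supp_in m u -> (1 <= m <= r)%N ->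
  flow r X u i (m + i) = u m.
Proof.
move=> hu hm; elim: i => [|i IH]; first by rewrite addn0.
rewrite flowS /bidiag; case: eqP => [|_]; first by lia.
case: ifP; last by lia.
by move=> _; rewrite addnS /= IH (flow_supp _ _ hu) ?mulr0 ?addr0 //; lia.
Qed.

Lemma flow_final r X u i l : (l <= i)%N -> flow r X u i.+1 l = flow r X u i l.
Proof.
move=> hl; rewrite flowS /bidiag; case: eqP => [|_]; first by lia.
by case: ifP => //; lia.
Qed.

Lemma flow_diag r X u i : flow r X u i.+1 i.+1 = X i.+1 i.+1 * flow r X u i i.+1.
Proof. by rewrite flowS /bidiag eqxx. Qed.

Lemma flow_rec r X u i l : (i.+1 < l <= i.+1 + r)%N ->
  flow r X u i.+1 l =
  flow r X u i l.-1 + X i.+1 l / X i.+1 l.-1 * flow r X u i l.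
Proof.
move=> hl; rewrite flowS /bidiag; case: eqP => [|_]; first by lia.
by case: ifP => //; lia.
Qed.

(** * The cyclic shift as a change of parameters *)

Section Shift.
Variables (n k : nat) (X Y : nat -> nat -> C) (t : C).
Hypothesis hk : (0 < k < n)%N.
Hypothesis X_neq0 : forall i j, in_R n k i j -> X i j != 0.
Hypothesis Y_neq0 : forall i j, in_R n k i j -> Y i j != 0.
Hypothesis Yt : Y 1 (1 + (n - k)) = t.
Hypothesis t_neq0 : t != 0.
Let a i j := X i j * tog_low k +%R GRing.inv 1 X Y i j.
Hypothesis XY : forall i j, in_R n k i j ->
  Y i j * a i j = tog_up n k +%R X Y i j.

Local Notation r := (n - k)%N.

(** Writing $s_l$ for this coefficient, $Y_{11}s_1=(-1)^{r-1}t$, and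
    $s_l+(Y_{1,l+1}/Y_{1l})s_{l+1}=0$ for $l<r$. So the first row of the [Y]-recursion produces the
    sign of [PR] at position $1$ and cancels the multiples of $u_r$ at positions $2,\dots,r$. *)
Definition shift_coef (l : nat) : C := (-1) ^+ (r - l) * t / Y 1 l.

Definition shift_in u (l : nat) : C :=
  if (1 <= l <= r)%N then u l.-1 + shift_coef l * u r else 0.

Lemma supp_shift_in u : supp_in r (shift_in u).
Proof. by move=> l; rewrite /shift_in => /negbTE->. Qed.

(** Induction on the row. The first two clauses concern final coordinates. The third describes the
    window still in motion, in terms of the [X]-state one row earlier; at its left end the
    predecessor is absent, as in the diagonal rule of [bidiag]. *)
Lemma flow_shift u i : supp_in r u -> (i < k)%N ->
  [/\ flow r Y (shift_in u) i.+1 1 = (-1) ^+ r.-1 * t * u r,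
      forall l, (2 <= l <= i.+1)%N ->
        flow r Y (shift_in u) i.+1 l = flow r X u i.+1 l.-1
    & forall j, (i < j <= i + r)%N ->
        flow r Y (shift_in u) i.+1 j.+1 =
        (if (i.+1 < j)%N then flow r X u i j.-1 else 0)
        + a i.+1 j * flow r X u i j].
Proof.
move=> hu; have hr : (0 < r)%N by lia.
elim: i => [|i IH] hik.
  have Y1 j : (0 < j <= r)%N -> Y 1 j != 0 by move=> hj; apply: Y_neq0; rewrite /in_R; lia.
  split=> [|l|j hj]; [|lia|].
    rewrite flow_diag /flow /shift_in hr /= hu // add0r /shift_coef subn1.
    by field; apply: Y1; lia.
  have aE : a 1 j = Y 1 j.+1 / Y 1 j.
    have := XY (i := 1) (j := j); rewrite /tog_up /= => <-; last by rewrite /in_R; lia.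
    by field; apply: Y1; lia.
  rewrite flow_rec ?aE; last by lia.
  rewrite /flow /= /shift_in; have -> : (0 < j <= r)%N by lia.
  (* At $j=1$ the dropped term is $u_0=0$. *)
  have -> : (if (1 < j)%N then u j.-1 else 0) = u j.-1.
    by case: ifP => // h; rewrite hu //; lia.
  rewrite /shift_coef; case: (ltnP j r) => jr /=.
    have -> : (r - j = (r - j.+1).+1)%N by lia.
    rewrite exprS; field; rewrite !Y1 //; lia.
  (* Here $Y_{1,r+1}=t$ and [shift_in] vanishes beyond $r$, so the surviving multiple of $u_r$ is
     $t/Y_{1r}=a_{1r}$. *)
  have -> : j = r by lia.
  rewrite subnn Yt mulr0 addr0; field; apply: Y1; lia.
have [IH1 IH2 IH3] := IH (ltnW hik).
have aE : a i.+1 i.+1 = X i.+1 i.+1 / Y i.+2 i.+2.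
  by rewrite /a /tog_low eqxx; case: eqP; [lia | move=> _].
have fX : flow r X u i.+2 i.+1 = flow r X u i.+1 i.+1 by rewrite flow_final.
split=> [|l hl|j hj]; first by rewrite flow_final.
  case: (ltnP l i.+2) => li; first by rewrite flow_final ?IH2 ?flow_final //; lia.
  have -> : l = i.+2 by lia.
  (* $Y_{i+2,i+2}\,a_{i+1,i+1}=X_{i+1,i+1}$ is the diagonal factor of the [X]-recursion. *)
  rewrite flow_diag IH3 ?ltnn ?add0r ?aE /= ?fX ?flow_diag; last by lia.
  by field; apply: Y_neq0; rewrite /in_R; lia.
rewrite flow_rec /=; last by lia.
have Yj : Y i.+2 j != 0 by apply: Y_neq0; rewrite /in_R; lia.
have Xj : X i.+1 j.-1 != 0 by apply: X_neq0; rewrite /in_R; lia.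
have aj : a i.+1 j.-1 =
   (if (i.+2 < j)%N then X i.+1 j.-1 / X i.+1 j.-2 else 0) + X i.+1 j.-1 / Y i.+2 j.
  rewrite /a /tog_low.
  have -> : (j.-1 == i.+1) = ~~ (i.+2 < j)%N by lia.
  have /negbTE-> : i.+1 != k by lia.
  by rewrite prednK; [case: (ltnP i.+2 j) => _ /=; rewrite ?mulrDr ?add0r | lia].
have aup : a i.+2 j = (X i.+1 j.-1 + (if (j < i.+1 + r)%N then Y i.+2 j.+1 else 0)) / Y i.+2 j.
  have H : in_R n k i.+2 j by rewrite /in_R; lia.
  have := XY H; rewrite /tog_up /=.
  have -> : (j.+1 == i.+2 + r)%N = ~~ (j < i.+1 + r)%N by lia.
  by case: ltnP => _ /= <-; rewrite ?addr0 mulrC mulKf.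
have e1 := IH3 j.-1; rewrite prednK in e1; last by lia.
rewrite e1; last by lia.
have fj : flow r X u i.+1 j = flow r X u i j.-1 + X i.+1 j / X i.+1 j.-1 * flow r X u i j.
  by rewrite flow_rec //; lia.
rewrite fj.
have -> : (i.+1 < j.-1)%N = (i.+2 < j)%N by lia.
have e2 : (if (i.+2 < j)%N then flow r X u i.+1 j.-1 else 0) =
   if (i.+2 < j)%N then flow r X u i j.-2 + X i.+1 j.-1 / X i.+1 j.-2 * flow r X u i j.-1 else 0.
  by case: ifP => // h; rewrite flow_rec //; lia.
rewrite e2 aj aup.
have Xj2 : (i.+2 < j)%N -> X i.+1 j.-2 != 0.
  by move=> h; apply: X_neq0; rewrite /in_R; lia.
case: (ltnP j (i.+1 + r)) => jr.
  have Yj1 : Y i.+2 j.+1 != 0 by apply: Y_neq0; rewrite /in_R; lia.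
  have aj1 : a i.+1 j = X i.+1 j / X i.+1 j.-1 + X i.+1 j / Y i.+2 j.+1.
    rewrite /a /tog_low; have /negbTE-> : j != i.+1 by lia.
    have /negbTE-> : i.+1 != k by lia.
    by rewrite mulrDr.
  rewrite IH3 ?aj1; last by lia.
  have -> : (i.+1 < j)%N by lia.
  case: ifP => [/Xj2 h|_]; field; rewrite ?h ?Yj ?Yj1 ?Xj //.
(* At the right end of the row the next cell holds $t$, but it multiplies a coordinate beyond the
   support. This is why the toggle equations of rows $i\ge2$ do not contain $t$. *)
rewrite (flow_supp _ _ (supp_shift_in u)); last by lia.
rewrite [flow r X u i j](flow_supp _ _ hu); last by lia.
case: ifP => [/Xj2 h|_]; field; rewrite ?h ?Yj ?Xj //.
Qed.

(** In row $k$ there is no term from below, so $a_{kj}$ is $X_{kj}/X_{k,j-1}$, or $X_{kk}$ on the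
    diagonal, and the window of [flow_shift] is row $k$ of the [X]-recursion itself. The wrapped
    coordinate is $u_r$, which [flow_top] finds at position $n$. *)
Lemma flow_promotion u l : supp_in r u -> (1 <= l <= n)%N ->
  flow r Y (shift_in u) k l =
  if l == 1%N then (-1) ^+ r.-1 * t * flow r X u k n else flow r X u k l.-1.
Proof.
move=> hu hl; have kE : k = k.-1.+1 by lia.
have [e1 e2 e3] : _ := flow_shift hu (i := k.-1) ltac:(lia).
rewrite -!kE in e1 e2 e3.
have un : flow r X u k n = u r.
  have := flow_top X k hu (r := r); rewrite subnK; last by lia.
  by apply; lia.
case: eqP => [->|l1]; first by rewrite un e1.
case: (leqP l k) => lk; first by rewrite e2 //; lia.
have := e3 l.-1; rewrite prednK; last by lia.
move=> ->; last by lia.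
have lowE : a k l.-1 = if l.-1 == k then X k k else X k l.-1 / X k l.-2.
  by rewrite /a /tog_low eqxx; case: eqP => [->|_]; rewrite ?mulr1.
rewrite lowE; case: eqP => lk1.
  have -> : (k < l.-1)%N = false by lia.
  rewrite lk1 add0r.
  by have := flow_diag r X u k.-1; rewrite -kE.
have -> : (k < l.-1)%N by lia.
by have := @flow_rec r X u k.-1 l.-1; rewrite -kE => -> //; lia.
Qed.

(** $v_1$ determines $u_r$, and then $v_{l+1}$ determines $u_l$. This gives the inclusion of
    $\Theta(Y)$ in the shifted span; the opposite one follows from [flow_promotion] alone. *)
Lemma shift_in_surj v : supp_in r v ->
  exists2 u, supp_in r u & forall l, shift_in u l = v l.
Proof.
move=> hv; have hr : (0 < r)%N by lia.
have sc l : (1 <= l <= r)%N -> shift_coef l != 0.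
  move=> hl; rewrite /shift_coef !mulf_neq0 ?invr_eq0 ?expf_neq0 ?oppr_eq0 ?oner_neq0 //.
  by apply: Y_neq0; rewrite /in_R; lia.
pose w := v 1 / shift_coef 1.
exists (fun l => if l == r then w else
         if (1 <= l <= r)%N then v l.+1 - shift_coef l.+1 * w else 0).
  by move=> l hl; case: eqP => [|_]; [lia | rewrite (negbTE hl)].
move=> l; rewrite /shift_in; case: ifP => [hl|/negbT/hv->//].
rewrite eqxx; have /negbTE-> : l.-1 != r by lia.
case: (l =P 1%N) => [->|l1] /=.
  by rewrite add0r /w mulrC divfK ?sc //; lia.
have -> : (0 < l.-1 <= r)%N by lia.
by rewrite prednK ?subrK //; lia.
Qed.

End Shift.

(** * Recovering the parameters from the span *)

Section Injectivity.
Variables (n k : nat) (X Y : nat -> nat -> C).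
Hypothesis hk : (0 < k < n)%N.
Hypothesis Y_neq0 : forall i j, in_R n k i j -> Y i j != 0.
Local Notation r := (n - k)%N.

Hypothesis sub_flow : forall u, supp_in r u -> exists2 v, supp_in r v &
  forall l, (1 <= l <= n)%N -> flow r X u k l = flow r Y v k l.

(** A row can be inverted from left to right: the diagonal output gives the input at $i+1$, and each
    later output the next input. Only parameters left of $m$ enter, so the lemma applies to a row
    that is known in part. *)
Lemma row_peel i u v : (i < k)%N -> supp_in r u -> supp_in r v ->
  (forall l, (1 <= l <= n)%N -> flow r X u i.+1 l = flow r Y v i.+1 l) ->
  forall m, (forall j, (i < j < m)%N -> X i.+1 j = Y i.+1 j) ->
  forall l, (i < l < m)%N -> (l <= i + r)%N -> flow r X u i l = flow r Y v i l.
Proof.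
move=> hi hu hv e m hm; elim=> [|l IH] hl hlr; first by lia.
have XYl := hm l.+1 hl.
have Yl : Y i.+1 l.+1 != 0 by apply: Y_neq0; rewrite /in_R; lia.
have el := e l.+1.
case: (l =P i) => [li|li].
  rewrite li in XYl Yl el *; rewrite !flow_diag XYl in el.
  by apply: (mulfI Yl); apply: el; lia.
rewrite !flow_rec ?XYl /= ?hm ?IH in el; try lia.
have Yl1 : Y i.+1 l != 0 by apply: Y_neq0; rewrite /in_R; lia.
have := el ltac:(lia); move/addrI/mulfI; apply.
by rewrite mulf_neq0 ?invr_eq0.
Qed.

(** Descending induction: row $k$, applied last, is peeled first, and the inclusion of the spaces of
    states is carried along to the row before. *)
Lemma flow_inj_rows i : (i <= k)%N ->
  (forall i' j, (i < i')%N -> in_R n k i' j -> X i' j = Y i' j) /\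
  (forall u, supp_in r u -> exists2 v, supp_in r v &
     forall l, (1 <= l <= n)%N -> flow r X u i l = flow r Y v i l).
Proof.
move=> hi; have -> : i = (k - (k - i))%N by lia.
elim: (k - i)%N => [|d IH] {hi}.
  by rewrite subn0; split=> // i' j hi'; rewrite /in_R; lia.
case: (ltnP d k) => hd; last first.
  by have <- : (k - d = k - d.+1)%N by lia.
move: IH; have -> : (k - d = (k - d.+1).+1)%N by lia.
move: (k - d.+1)%N (ltac:(lia) : (k - d.+1 < k)%N) => {d hd} i hi [hrow hflow].
have rowE j : in_R n k i.+1 j -> X i.+1 j = Y i.+1 j.
  elim/ltn_ind: j => j IH hj.
  have hjr : (i < j <= i + r)%N by move: hj; rewrite /in_R; lia.
  (* The input $e_{j-i}$ makes the [X]-state after row $i$ end at position $j$ with value $1$, so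
     the next row's output at $j$ exhibits the parameter $X_{i+1,j}$. *)
  pose u l : C := (l == (j - i)%N)%:R.
  have hu' : supp_in (j - i) u by move=> l hl; rewrite /u; case: eqP => //; lia.
  have hu : supp_in r u by move=> l hl; apply: hu'; lia.
  have [v hv e] := hflow u hu.
  have uj : flow r X u i j = 1.
    have {1}-> : j = (j - i + i)%N by lia.
    by rewrite (flow_top _ _ hu') ?/u ?eqxx //; lia.
  have u0 l : (j < l)%N -> flow r X u i l = 0.
    by move=> hl; rewrite (flow_supp _ _ hu') //; lia.
  (* From the right end inwards: the states vanish beyond $j$, so the unknown ratios of [Y] multiply
     zeros and equal outputs give equal states one position to the left. *)
  have v0 d : (d <= i + r - j)%N ->
     flow r Y v i (i + r - d) = flow r X u i (i + r - d).
    elim: d => [|d IHd] hd.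
      have := e (i + r).+1; rewrite !flow_rec /= ?subn0; try lia.
      rewrite [flow _ _ u i _.+1](flow_supp _ _ hu) ?ltnS ?[(r + i)%N]addnC //.
      rewrite [flow _ _ v i _.+1](flow_supp _ _ hv) ?ltnS ?[(r + i)%N]addnC //.
      by rewrite !mulr0 !addr0 => -> //; lia.
    have := e (i + r - d)%N; rewrite !flow_rec; try lia.
    have -> : (i + r - d).-1 = (i + r - d.+1)%N by lia.
    rewrite IHd; last by lia.
    by rewrite (u0 (i + r - d)%N) ?mulr0 ?addr0 => [->//|]; lia.
  have vj : flow r Y v i j = 1.
    by have := v0 _ (leqnn _); rewrite subKn ?uj //; lia.
  (* Left of $j$ the parameters agree by induction, hence so do the states; the outputs at $j$ then
     compare the two parameters. *)
  have low := row_peel hi hu hv e (m := j).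
  have := e j; case: (j =P i.+1) => [ji|ji].
    rewrite ji !flow_diag -ji uj vj !mulr1 => -> //; lia.
  rewrite !flow_rec ?uj ?vj ?mulr1; try lia.
  rewrite (low _ j.-1); try lia; last by move=> l hl; apply: IH; rewrite /in_R; lia.
  move=> /(_ ltac:(lia)) /addrI.
  have jm : in_R n k i.+1 j.-1 by rewrite /in_R; lia.
  rewrite (IH j.-1) //; last by lia.
  by move=> /(congr1 (fun z => z * Y i.+1 j.-1)); rewrite !divfK ?Y_neq0.
split=> [i' j hi' hij|u hu].
  by case: (ltngtP i' i.+1) => [|h|e]; [lia | exact: hrow | rewrite e rowE // -e].
have [v hv e] := hflow u hu; exists v => // l hl.
case: (ltnP i l) => il; last by have := e l hl; rewrite !flow_final.
case: (leqP l (i + r)) => lr; last first.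
  by rewrite (flow_supp _ _ hu) ?(flow_supp _ _ hv) //; lia.
apply: (row_peel hi hu hv e (m := l.+1)) => //; last by lia.
by move=> j hj; apply: rowE; rewrite /in_R; lia.
Qed.

Lemma flow_inj i j : in_R n k i j -> X i j = Y i j.
Proof.
by move=> hij; apply: (flow_inj_rows (leq0n k)).1 => //; move: hij; rewrite /in_R; lia.
Qed.

End Injectivity.
End Flow.

(** * From the recursions to [Theta] and [PR] *)

Section Arrays.
Variables (n k : nat).

Lemma mem_Rset i j : ((i, j) \in Rset n k) = in_R n k i j.
Proof.
apply/allpairsPdep/idP => [[i' [j' [hi hj [-> ->]]]]|h].
  by move: hi hj; rewrite !mem_iota /in_R; lia.
by exists i, j; split=> //; rewrite mem_iota; move: h; rewrite /in_R; lia.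
Qed.

Lemma array_Some (V : nmodType) (x : coords n k -> V) (ij : seq_sub (Rset n k)) :
  array x (val ij).1 (val ij).2 = x (Some ij).
Proof.
by rewrite /array -surjective_pairing valK.
Qed.

Lemma array_in (V : nmodType) (x : coords n k -> V) i j (h : (i, j) \in Rset n k) :
  array x i j = x (Some (SeqSub h)).
Proof. by rewrite -array_Some. Qed.

Lemma array_out (V : nmodType) (x : coords n k -> V) i j : ~~ in_R n k i j ->
  array x i j = if (i + (n - k) <= j)%N then x None else 0.
Proof. by move=> h; rewrite /array insubN // mem_Rset. Qed.

Lemma array_t (V : nmodType) (x : coords n k -> V) : array x 1 (1 + (n - k)) = x None.
Proof. by rewrite array_out ?leqnn // /in_R; lia. Qed.

End Arrays.

Section ThetaPR.
Variables (C : fieldType) (n k : nat).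
Hypothesis hk : (0 < k < n)%N.
Implicit Types x y : coords n k -> C.

Lemma torus_array x i j : torus x -> in_R n k i j -> array x i j != 0.
Proof. by move=> hx; rewrite -mem_Rset => h; rewrite (array_in x h); apply: hx. Qed.

Let kn : (k <= n)%N.
Proof. by lia. Qed.

Lemma Theta_prom x y : torus x -> torus y -> y None = x None ->
  (forall i j, in_R n k i j ->
     array y i j * (array x i j *
        tog_low k +%R GRing.inv 1 (array x) (array y) i j) =
     tog_up n k +%R (array x) (array y) i j) ->
  Theta y = PR (n - k) (Theta x).
Proof.
move=> tx ty xyt XY; rewrite (surjective_pairing (PR _ _)) [RHS]/=.
rewrite [LHS](surjective_pairing (Theta y)); congr pair; last exact: xyt.
have Yt : array y 1 (1 + (n - k)) = x None by rewrite array_t.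
have tp := flow_promotion hk (fun i j => torus_array tx (j := j))
  (fun i j => torus_array ty (j := j)) Yt (tx None) XY.
apply/vspaceP => w; apply/idP/idP.
  move/(mem_Theta _ _ kn) => [v hv ->].
  have [u hu uv] := shift_in_surj hk (fun i j => torus_array ty (j := j)) (tx None) hv.
  apply/mem_PR; exists (vec n (flow (n - k) (array x) u k)).
    by apply/(mem_Theta _ _ kn); exists u.
  rewrite shift_rows_vec; apply: eq_vec => l hl; rewrite -tp //.
  by congr (flow _ _ _ _ _); apply: funext => m; rewrite uv.
move/mem_PR => [v /(mem_Theta _ _ kn)[u hu ->] ->].
apply/(mem_Theta _ _ kn); exists (shift_in n k (array y) (x None) u); first exact: supp_shift_in.
by rewrite shift_rows_vec; apply: eq_vec => l hl; rewrite tp.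
Qed.

Lemma Theta_inj x y : torus x -> torus y -> Theta x = Theta y -> x = y.
Proof.
move=> tx ty e; apply: funext => -[ij|]; last by case: e.
rewrite -!array_Some; apply: (flow_inj hk) => [i j|u hu|].
- exact: torus_array.
- have : vec n (flow (n - k) (array x) u k) \in (Theta y).1.
    by rewrite -e; apply/(mem_Theta _ _ kn); exists u.
  by move/(mem_Theta _ _ kn) => [v hv /vec_eq vE]; exists v.
by rewrite -mem_Rset -surjective_pairing; case: (ij).
Qed.

End ThetaPR.

(** * Generic values of rational functions *)

Lemma poly_nonroot (C : numDomainType) (p : {poly C}) : p != 0 ->
  exists s, p.[s] != 0.
Proof.
move=> p0; apply: contrapT => H.
pose s := [seq i%:R : C | i <- iota 0 (size p)].
have us : uniq s by rewrite map_inj_uniq ?iota_uniq // => i j /eqP; rewrite eqr_nat => /eqP.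
have := max_poly_roots p0 _ us; rewrite size_map size_iota ltnn => H'.
suff : false by []; apply: H'; apply/allP => a _.
by apply/negPn/negP => ha; apply: H; exists a.
Qed.

Section Muni.
Variables (C : comNzRingType) (N : nat).

Lemma meval_muni (p : {mpoly C[N.+1]}) (v : 'I_N.+1 -> C) :
  p.@[v] = (map_poly (meval (fun i => v (widen_ord (leqnSn N) i))) (muni p)).[v ord_max].
Proof.
rewrite mevalE muniE rmorph_sum horner_sum; apply: eq_bigr => m _ /=.
rewrite map_polyZ /= map_polyXn hornerZ hornerXn mevalZ mevalX big_ord_recr /= mulrA.
by congr (_ * _ * _); apply: eq_bigr => i _; rewrite mnmE.
Qed.

(** A monomial is determined by its last exponent and its restriction to the other variables, so
    every coefficient of [p] can be read off [muni p]. *)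
Lemma muni_eq0 (p : {mpoly C[N.+1]}) : muni p = 0 -> p = 0.
Proof.
move=> p0; apply/mpolyP => m0; rewrite mcoeff0; apply/eqP.
rewrite mcoeff_eq0; apply/negP => hm0.
pose res (m : 'X_{1..N.+1}) := [multinom m (widen_ord (leqnSn N) i) | i < N].
have := congr1 (fun q : {poly {mpoly C[N]}} => (q`_(m0 ord_max))@_(res m0)) p0.
rewrite muniE coef_sum raddf_sum /= coef0 mcoeff0.
rewrite (bigD1_seq m0) ?msupp_uniq //= big1 ?addr0.
  rewrite coefZ coefXn eqxx mulr1 mcoeffZ mcoeffX eqxx mulr1.
  by move/eqP; rewrite mcoeff_eq0 hm0.
move=> m nm; rewrite coefZ coefXn; case: eqP => e; last by rewrite mulr0 mcoeff0.
rewrite mulr1 mcoeffZ mcoeffX; case: eqP => e'; last by rewrite mulr0.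
case/eqP: nm; apply/mnmP => i; case: (unliftP ord_max i) => [j|] -> //.
have := congr1 (fun q : 'X_{1..N} => q j) e'; rewrite !mnmE.
have -> : widen_ord (leqnSn N) j = lift ord_max j by apply/val_inj; rewrite /= /bump leqNgt ltn_ord.
by [].
Qed.
End Muni.

(** Induction on the number of variables: specialize all but the last so that the leading
    coefficient in the last one survives, then take a nonroot of the resulting univariate
    polynomial. *)
Lemma mpoly_nonroot (C : numDomainType) N (p : {mpoly C[N]}) : p != 0 ->
  exists v, p.@[v] != 0.
Proof.
elim: N p => [|N IH] p p0.
  exists (fun=> 0); apply: contraNneq p0 => e; apply/eqP/mpolyP => m.
  rewrite mcoeff0 -e mevalE.
  have m0 (m' : 'X_{1..0}) : m' = m by apply/mnmP => -[].
  case: (boolP (m \in msupp p)) => hm; last first.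
    by rewrite big1_seq ?memN_msupp_eq0 // => m' /=; rewrite (m0 m') (negbTE hm).
  rewrite (bigD1_seq m) ?msupp_uniq //= big_ord0 mulr1 big1 ?addr0 // => m'.
  by rewrite (m0 m') eqxx.
have q0 : muni p != 0 by apply: contraNneq p0 => /muni_eq0->.
have [v hv] : exists v, (lead_coef (muni p)).@[v] != 0.
  by apply: IH; rewrite lead_coef_eq0.
have r0 : map_poly (meval v) (muni p) != 0.
  apply: contraNneq hv => e.
  by have := coef_map (meval v) (muni p) (size (muni p)).-1; rewrite e coef0 => <-.
have [s hs] := poly_nonroot r0.
exists (fun i => if unlift ord_max i is Some j then v j else s).
rewrite meval_muni unlift_none; congr (_ != 0): hs; congr (_.[_]).
apply: eq_map_poly => q; apply: meval_eq => i.
have -> : widen_ord (leqnSn N) i = lift ord_max i.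
  by apply/val_inj; rewrite /= /bump leqNgt ltn_ord.
by rewrite liftK.
Qed.

Section Fractions.
Variable D : idomainType.
Implicit Types p q : D.

Lemma tofrac_div_eq p q p' q' : q != 0 -> q' != 0 ->
  (tofrac p / tofrac q == tofrac p' / tofrac q') = (p * q' == p' * q).
Proof.
move=> q0 q0'; have fq : tofrac q != 0 by rewrite tofrac_eq0.
have fq' : tofrac q' != 0 by rewrite tofrac_eq0.
by rewrite (eqr_div _ _ fq fq') -!tofracM tofrac_eq.
Qed.

Lemma tofrac_divD p q p' q' : q != 0 -> q' != 0 ->
  tofrac p / tofrac q + tofrac p' / tofrac q' =
  tofrac (p * q' + p' * q) / tofrac (q * q').
Proof. by move=> q0 q0'; rewrite addf_div ?tofrac_eq0 // -!tofracM -tofracD. Qed.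

Lemma tofrac_divM p q p' q' :
  tofrac p / tofrac q * (tofrac p' / tofrac q') =
  tofrac (p * p') / tofrac (q * q').
Proof. by rewrite mulf_div -!tofracM. Qed.

Lemma tofrac_divV p q : (tofrac p / tofrac q)^-1 = tofrac q / tofrac p.
Proof. exact: invf_div. Qed.

End Fractions.

Section Values.
Variables (C : fieldType) (n m : nat).
Local Notation N := #|coords n m|.
Implicit Types (x : coords n m -> C) (f g : ratfun C n m) (p q : {mpoly C[N]}).

Lemma pevalD p q x : peval (p + q) x = peval p x + peval q x.
Proof. exact: mevalD. Qed.
Lemma pevalM p q x : peval (p * q) x = peval p x * peval q x.
Proof. exact: mevalM. Qed.
Lemma pevalB p q x : peval (p - q) x = peval p x - peval q x.
Proof. exact: mevalB. Qed.
Lemma peval1 x : peval 1 x = 1.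
Proof. exact: meval1. Qed.

Lemma peval_neq0 p x : peval p x != 0 -> p != 0.
Proof. by apply: contraNneq => ->; rewrite /peval meval0. Qed.

Lemma has_value_uniq f x a b : has_value f x a -> has_value f x b -> a = b.
Proof.
case=> p [q [-> hq ->]] [p' [q' [e hq' ->]]].
move/eqP: e; rewrite (tofrac_div_eq _ _ (peval_neq0 hq) (peval_neq0 hq')).
move=> /eqP/(congr1 (fun h : {mpoly C[N]} => peval h x)); rewrite !pevalM => e.
by apply/eqP; rewrite eqr_div // e.
Qed.

Lemma has_valueD f g x a b : has_value f x a -> has_value g x b ->
  has_value (f + g) x (a + b).
Proof.
case=> p [q [-> hq ->]] [p' [q' [-> hq' ->]]].
have q0 := peval_neq0 hq; have q0' := peval_neq0 hq'.
exists (p * q' + p' * q), (q * q'); rewrite pevalD !pevalM mulf_neq0 //; split=> //.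
  exact: tofrac_divD.
by rewrite addf_div.
Qed.

Lemma has_valueM f g x a b : has_value f x a -> has_value g x b ->
  has_value (f * g) x (a * b).
Proof.
case=> p [q [-> hq ->]] [p' [q' [-> hq' ->]]].
exists (p * p'), (q * q'); rewrite !pevalM mulf_neq0 //; split=> //.
  exact: tofrac_divM.
by rewrite mulf_div.
Qed.

Lemma has_valueV f x a : a != 0 -> has_value f x a -> has_value f^-1 x a^-1.
Proof.
move=> a0 [p [q [fE hq aE]]]; exists q, p; split.
- by rewrite fE tofrac_divV.
- by apply: contraNneq a0 => e; rewrite aE e mul0r.
- by rewrite aE invf_div.
Qed.

Lemma has_value1 x : has_value (1 : ratfun C n m) x 1.
Proof. by exists 1, 1; rewrite tofrac1 peval1 !divr1 oner_neq0. Qed.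

Definition coord_fun (v : coords n m) : ratfun C n m := tofrac 'X_(enum_rank v).

Lemma has_value_coord v x : has_value (coord_fun v) x (x v).
Proof.
exists 'X_(enum_rank v), 1; rewrite tofrac1 peval1 !divr1 oner_neq0.
by split=> //; rewrite /peval mevalXU enum_rankK.
Qed.

End Values.

Section Generic.
Variables (C : numFieldType) (n m : nat).
Local Notation N := #|coords n m|.
Implicit Types (x : coords n m -> C) (f g : ratfun C n m) (h p q : {mpoly C[N]}).

Lemma generic_point h : h != 0 -> exists2 x, torus x & peval h x != 0.
Proof.
(* The product of all variables forces the nonroot into the torus. *)
move=> h0; pose M : {mpoly C[N]} := 'X_[[multinom 1%N | i < N]].
have M0 : M != 0 by rewrite -msupp_eq0 msuppX.
have [v hv] := mpoly_nonroot (mulf_neq0 h0 M0).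
move: hv; rewrite mevalM mulf_eq0 negb_or => /andP[hv].
rewrite mevalX => /prodf_neq0 vM.
exists (fun w => v (enum_rank w)) => [w|].
  by have := vM (enum_rank w) isT; rewrite mnmE expr1.
by congr (_ != 0): hv; apply: meval_eq => i; rewrite enum_valK.
Qed.

Definition is_frac f := exists p q, [/\ p != 0, q != 0 & f = tofrac p / tofrac q].

(** [h] is the product of all numerators and denominators. Nonzero values are wanted so that the
    image point lies in the torus and inverses can be evaluated. *)
Lemma generic_values (s : seq (ratfun C n m)) : (forall f, f \in s -> is_frac f) ->
  exists2 h, h != 0 & forall x, peval h x != 0 -> forall f, f \in s ->
    exists2 a, a != 0 & has_value f x a.
Proof.
elim: s => [|f s IH] H; first by exists 1; rewrite ?oner_neq0.
have [g hg|h h0 hh] := IH; first by apply: H; rewrite inE hg orbT.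
have [p [q [p0 q0 fE]]] := H f (mem_head _ _).
exists (h * (p * q)); first by rewrite !mulf_neq0.
move=> x; rewrite !pevalM !mulf_eq0 !negb_or => /andP[hx /andP[px qx]] g.
rewrite inE => /orP[/eqP->|]; last exact: hh.
exists (peval p x / peval q x); first by rewrite mulf_neq0 ?invr_eq0.
by exists p, q.
Qed.

(** If the cross-multiplied difference were a nonzero polynomial, it would be nonzero at some
    generic point where both values agree. A fraction for [f] is supplied by [has_value] at one such
    point. *)
Lemma ratfun_eq f g h : is_frac g -> h != 0 ->
  (forall x, torus x -> peval h x != 0 ->
     exists2 a, has_value f x a & has_value g x a) -> f = g.
Proof.
move=> [p' [q' [p0' q0' gE]]] h0 H.
have [x0 tx0 hx0] := generic_point h0.
have [_ [p [q [fE hq _]]] _] := H x0 tx0 hx0.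
have q0 := peval_neq0 hq.
rewrite fE gE; apply/eqP; rewrite (tofrac_div_eq _ _ q0 q0') -subr_eq0.
apply/negPn/negP => d0.
have [x tx] := generic_point (mulf_neq0 h0 (mulf_neq0 d0 (mulf_neq0 q0 q0'))).
rewrite !pevalM !mulf_eq0 !negb_or => /and4P[hx dx qx qx'].
have [a fa ga] := H x tx hx.
have fa' : has_value f x (peval p x / peval q x) by exists p, q.
have ga' : has_value g x (peval p' x / peval q' x) by exists p', q'.
case/eqP: dx; rewrite pevalB !pevalM; apply/eqP; rewrite subr_eq0 -eqr_div //.
by rewrite -(has_value_uniq fa fa') -(has_value_uniq ga ga').
Qed.

End Generic.

(** * Tropicalization *)

Section TropPoly.
Variables (n m : nat).
Local Notation N := #|coords n m|.
Implicit Types (p q : {mpoly int[N]}) (b : coords n m -> int) (mo : 'X_{1..N}).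

Definition weight b mo : int := \sum_i b (enum_val i) *+ mo i.

Lemma weightD b m1 m2 : weight b (m1 + m2)%MM = weight b m1 + weight b m2.
Proof.
by rewrite /weight -big_split; apply: eq_bigr => i _; rewrite mnmDE mulrnDr.
Qed.

Lemma trop_poly_le p b mo : mo \in msupp p -> trop_poly p b <= weight b mo.
Proof.
move=> hmo; rewrite /trop_poly; set s := [seq _ | _ <- _].
by apply: ge_bigmin_seq => //; apply: (map_f (weight b)).
Qed.

Lemma trop_poly_mem p b : p != 0 ->
  exists2 mo, mo \in msupp p & trop_poly p b = weight b mo.
Proof.
rewrite -msupp_eq0 => p0; rewrite /trop_poly; set s := [seq _ | _ <- _].
have s0 : s != [::] by rewrite /s; case: (msupp p) p0.
suff : \big[Num.min/head 0 s]_(w <- s) w \in s by move/mapP.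
have hs : head 0 s \in s by case: (s) s0 => // a l _; exact: mem_head.
rewrite big_seq; elim/big_ind: _ => // a c ha hc.
by rewrite minEle; case: ifP.
Qed.

Lemma trop_poly_eq p b c mo : mo \in msupp p -> weight b mo = c ->
  (forall mo', mo' \in msupp p -> c <= weight b mo') -> trop_poly p b = c.
Proof.
move=> hmo e H; apply/le_anti; rewrite -{1}e trop_poly_le //=.
have p0 : p != 0 by apply: contraTneq hmo => ->; rewrite msupp0.
by have [mo' h ->] := trop_poly_mem b p0; apply: H.
Qed.

Definition sf_poly p := nonneg_poly p /\ p != 0.

Lemma msuppD_nonneg p q mo : nonneg_poly p -> nonneg_poly q ->
  (mo \in msupp (p + q)) = (mo \in msupp p) || (mo \in msupp q).
Proof.
move=> hp hq; rewrite !mcoeff_msupp mcoeffD -negb_and; congr (~~ _).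
by rewrite paddr_eq0.
Qed.

Lemma nonneg_polyD p q : nonneg_poly p -> nonneg_poly q -> nonneg_poly (p + q).
Proof. by move=> hp hq mo; rewrite mcoeffD addr_ge0. Qed.

Lemma nonneg_polyM p q : nonneg_poly p -> nonneg_poly q -> nonneg_poly (p * q).
Proof. by move=> hp hq mo; rewrite mcoeffM sumr_ge0 // => i _; rewrite mulr_ge0. Qed.

(* No cancellation can occur between nonnegative coefficients. *)
Lemma msuppM_nonneg p q m1 m2 : nonneg_poly p -> nonneg_poly q ->
  m1 \in msupp p -> m2 \in msupp q -> (m1 + m2)%MM \in msupp (p * q).
Proof.
move=> hp hq; rewrite !mcoeff_msupp => h1 h2; rewrite mcoeffM.
have d1 : (mdeg m1 < (mdeg (m1 + m2)%MM).+1)%N by rewrite mdegD ltnS leq_addr.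
have d2 : (mdeg m2 < (mdeg (m1 + m2)%MM).+1)%N by rewrite mdegD ltnS leq_addl.
rewrite (bigD1 (BMultinom d1, BMultinom d2)) //=.
rewrite paddr_eq0; first by rewrite negb_and mulf_neq0.
  by rewrite mulr_ge0.
by rewrite sumr_ge0 // => i _; rewrite mulr_ge0.
Qed.

Lemma sf_polyD p q : sf_poly p -> sf_poly q -> sf_poly (p + q).
Proof.
move=> [hp p0] [hq q0]; split; first exact: nonneg_polyD.
have [mo hmo _] := trop_poly_mem (fun=> 0) p0.
by apply/eqP => e; have := msuppD_nonneg mo hp hq; rewrite e msupp0 hmo.
Qed.

Lemma sf_polyM p q : sf_poly p -> sf_poly q -> sf_poly (p * q).
Proof. by move=> [hp p0] [hq q0]; split; [exact: nonneg_polyM | exact: mulf_neq0]. Qed.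

Lemma trop_polyD p q b : sf_poly p -> sf_poly q ->
  trop_poly (p + q) b = Num.min (trop_poly p b) (trop_poly q b).
Proof.
move=> [hp p0] [hq q0].
have [m1 h1 e1] := trop_poly_mem b p0; have [m2 h2 e2] := trop_poly_mem b q0.
have mem mo := msuppD_nonneg mo hp hq.
apply: (@trop_poly_eq _ _ _ (if weight b m1 <= weight b m2 then m1 else m2)).
- by rewrite mem; case: ifP => _; rewrite ?h1 ?h2 ?orbT.
- by rewrite e1 e2 minEle; case: ifP.
- move=> mo; rewrite mem ge_min => /orP[] h; first by rewrite trop_poly_le.
  by rewrite (trop_poly_le b h) orbT.
Qed.

Lemma trop_polyM p q b : sf_poly p -> sf_poly q ->
  trop_poly (p * q) b = trop_poly p b + trop_poly q b.
Proof.
move=> [hp p0] [hq q0].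
have [m1 h1 e1] := trop_poly_mem b p0; have [m2 h2 e2] := trop_poly_mem b q0.
apply: (@trop_poly_eq _ _ _ (m1 + m2)%MM).
- exact: msuppM_nonneg.
- by rewrite weightD e1 e2.
- move=> mo /msuppM_le/allpairsP[[m1' m2'] /= [h1' h2' ->]].
  by rewrite weightD lerD ?trop_poly_le.
Qed.

Lemma sf_polyX mo : sf_poly 'X_[mo].
Proof.
split; last by rewrite -msupp_eq0 msuppX.
by move=> mo'; rewrite mcoeffX ler0n.
Qed.

Lemma trop_polyX mo b : trop_poly 'X_[mo] b = weight b mo.
Proof.
have h : mo \in msupp ('X_[mo] : {mpoly int[N]}) by rewrite msuppX mem_head.
apply: (trop_poly_eq h) => // mo'; rewrite msuppX inE => /eqP->.
exact: lexx.
Qed.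

Lemma sf_poly1 : sf_poly 1.
Proof. by rewrite -mpolyX0; apply: sf_polyX. Qed.

Lemma trop_poly1 b : trop_poly 1 b = 0.
Proof. by rewrite -mpolyX0 trop_polyX /weight big1 // => i _; rewrite mnm0E mulr0n. Qed.

Lemma trop_polyXU v b : trop_poly 'X_(enum_rank v) b = b v.
Proof.
rewrite trop_polyX /weight (bigD1 (enum_rank v)) //= mnm1E eqxx mulr1n enum_rankK.
by rewrite big1 ?addr0 // => i /negbTE hi; rewrite mnm1E eq_sym hi mulr0n.
Qed.

End TropPoly.

Section TropFrac.
Variables (C : numFieldType) (n m : nat).
Local Notation N := #|coords n m|.
Implicit Types (f g : ratfun C n m) (p q : {mpoly int[N]}) (b : coords n m -> int).

Local Notation "p ^z" := (map_mpoly (intr : int -> C) p) (at level 2).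

(** Asking for some expression with tropical value [c] gives a relation that propagates through the
    field operations, whatever expression [Trop] picks; [TropE] reconciles the two. *)
Definition trop_val b f (c : int) := exists p q,
  [/\ sf_poly p, sf_poly q, f = tofrac p^z / tofrac q^z
    & c = trop_poly p b - trop_poly q b].

Lemma map_intr_inj p q : p^z = q^z -> p = q.
Proof.
move=> e; apply/mpolyP => mo; have := congr1 (mcoeff mo) e.
by rewrite !mcoeff_map_mpoly => /intr_inj.
Qed.

Lemma map_intr_neq0 p : p != 0 -> p^z != 0.
Proof. by apply: contraNneq => e; apply/eqP/map_intr_inj; rewrite e raddf0. Qed.

Lemma map_intrM p q : (p * q)^z = p^z * q^z.
Proof. exact: rmorphM. Qed.

Lemma map_intrD p q : (p + q)^z = p^z + q^z.
Proof. exact: rmorphD. Qed.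

Lemma trop_valD b f g c d : trop_val b f c -> trop_val b g d ->
  trop_val b (f + g) (Num.min c d).
Proof.
case=> p [q [hp hq -> ->]] [p' [q' [hp' hq' -> ->]]].
exists (p * q' + p' * q), (q * q'); split.
- by apply: sf_polyD; apply: sf_polyM.
- exact: sf_polyM.
- rewrite tofrac_divD; try by apply: map_intr_neq0; case: hq; case: hq'.
  by rewrite map_intrD !map_intrM.
- rewrite trop_polyD ?trop_polyM //; try exact: sf_polyM.
  by lia.
Qed.

Lemma trop_valM b f g c d : trop_val b f c -> trop_val b g d ->
  trop_val b (f * g) (c + d).
Proof.
case=> p [q [hp hq -> ->]] [p' [q' [hp' hq' -> ->]]].
exists (p * p'), (q * q'); split; try exact: sf_polyM.
- by rewrite tofrac_divM !map_intrM.
- by rewrite !trop_polyM //; lia.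
Qed.

Lemma trop_valV b f c : trop_val b f c -> trop_val b f^-1 (- c).
Proof.
case=> p [q [hp hq -> ->]]; exists q, p; split=> //; last by rewrite opprB.
exact: tofrac_divV.
Qed.

Lemma trop_val1 b : trop_val b 1 0.
Proof.
exists 1, 1; split; try exact: sf_poly1; last by rewrite subrr.
by rewrite rmorph1 tofrac1 divr1.
Qed.

Lemma trop_val_coord b v : trop_val b (coord_fun C v) (b v).
Proof.
exists 'X_(enum_rank v), 1; split; try exact: sf_poly1; try exact: sf_polyX.
- by rewrite rmorph1 tofrac1 divr1 map_mpolyX.
- by rewrite trop_polyXU trop_poly1 subr0.
Qed.

Lemma trop_val_frac b f c : trop_val b f c -> is_frac f.
Proof.
by case=> p [q [[_ p0] [_ q0] fE _]]; exists p^z, q^z; rewrite !map_intr_neq0.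
Qed.

Lemma trop_val_neq0 b f c : trop_val b f c -> f != 0.
Proof.
move=> /trop_val_frac[p [q [p0 q0 ->]]].
by apply: mulf_neq0; rewrite ?invr_eq0 tofrac_eq0.
Qed.

Lemma trop_val_sf b f c : trop_val b f c -> subtraction_free f.
Proof.
move=> h; split; first exact: trop_val_neq0 h.
by case: h => p [q [[hp p0] [hq q0] fE _]]; exists (p, q).
Qed.

(** Two expressions of [f], cross-multiplied, give an identity of integer polynomials because the
    characteristic is zero, and [trop_poly] is additive on products. *)
Lemma TropE b f c : trop_val b f c -> Trop f b = c.
Proof.
move=> h; have f0 := trop_val_neq0 h.
case: h => p [q [[hp p0] [hq q0] fE ->]]; rewrite /Trop.
have hpq : [set pq | sf_expr f pq]%classic (p, q) by [].
case: xgetP => [[p' q'] _ [/= [hp' hq'] q0' fE']|/(_ _ hpq)//].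
have p0' : p' != 0.
  by apply: contraNneq f0 => e; rewrite fE' e raddf0 tofrac0 mul0r.
have /eqP := etrans (esym fE) fE'.
rewrite tofrac_div_eq ?map_intr_neq0 // -!map_intrM => /eqP/map_intr_inj e.
have := congr1 (fun z => trop_poly z b) e; rewrite !trop_polyM //.
by lia.
Qed.

End TropFrac.

(** * Gelfand-Tsetlin patterns and tableaux *)

Lemma card_ord_itv (L a e : nat) : (e <= L)%N ->
  #|[set d : 'I_L | (a <= d < e)%N]| = (e - a)%N.
Proof.
move=> eL; rewrite -sum1dep_card -(big_mkord (fun d => (a <= d < e)%N) (fun=> 1%N)).
rewrite -[RHS]muln1 -sum_nat_const_nat (big_nat_widenl a 0 e) //.
by rewrite (big_nat_widen 0 e L).
Qed.

Lemma downset_card (L : nat) (S : {set 'I_L}) :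
  (forall c d : 'I_L, (c <= d)%N -> d \in S -> c \in S) ->
  forall c : 'I_L, (c \in S) = (c < #|S|)%N.
Proof.
move=> hS c; apply/idP/idP => hc.
  have <- : #|[set d : 'I_L | (0 <= d < c.+1)%N]| = c.+1.
    by rewrite card_ord_itv ?subn0.
  by apply/subset_leq_card/fintype.subsetP => d; rewrite inE => hd; apply: hS hc; lia.
apply: contraLR hc => hc; rewrite -leqNgt.
have <- : #|[set d : 'I_L | (0 <= d < c)%N]| = c.
  by rewrite card_ord_itv ?subn0 // ltnW.
apply/subset_leq_card/fintype.subsetP => d hd; rewrite inE /= ltnNge.
by apply: contra hc => hcd; apply: hS hd.
Qed.

Section GT.
Variables (n k L : nat).
Hypothesis hk : (0 < k < n)%N.
Implicit Types (A : nat -> nat -> int) (T : 'M[nat]_(k, L)).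

(** Rows $1,\dots,k$ are continued to all columns, by $0$ left of the diagonal and by $L$ on the
    right, so that neighbours always exist within a row. *)
Definition gt_array A : Prop :=
  [/\ forall i j, (1 <= i <= k)%N -> A i j <= A i j.+1,
      forall i j, (1 <= i < k)%N -> A i.+1 j.+1 <= A i j,
      forall i j, (1 <= i <= k)%N -> (j < i)%N -> A i j = 0
    & forall i j, (1 <= i <= k)%N -> (i + (n - k) <= j)%N -> A i j = L%:Z].

(** In a weakly increasing row the entries at most $j$ fill an initial segment, so their number is
    compared with the column index, which starts at $0$. Row monotonicity is thereby built in. *)
Definition represents T A : Prop :=
  forall (i : 'I_k) (c : 'I_L) j, (T i c <= j)%N = (c%:Z < A i.+1 j).

Lemma gt_row A i j j' : gt_array A -> (1 <= i <= k)%N -> (j <= j')%N ->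
  A i j <= A i j'.
Proof.
move=> [H _ _ _] hi /subnKC <-; elim: (j' - j)%N => [|d IH]; first by rewrite addn0.
by rewrite addnS; apply: le_trans IH _; apply: H.
Qed.

Lemma gt_ge0 A i j : gt_array A -> (1 <= i <= k)%N -> 0 <= A i j.
Proof.
move=> H hi; case: (H) => _ _ H0 _; rewrite -(H0 i 0%N) //; last by lia.
exact: gt_row.
Qed.

Lemma gt_leL A i j : gt_array A -> (1 <= i <= k)%N -> A i j <= L%:Z.
Proof.
move=> H hi; case: (H) => _ _ _ HL.
rewrite -(HL i (maxn j (i + (n - k)))%N) //; last exact: leq_maxr.
by apply: gt_row => //; exact: leq_maxl.
Qed.

Lemma gt_col A i i' j : gt_array A -> (1 <= i < i')%N -> (i' <= k)%N ->
  A i' j.+1 <= A i j.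
Proof.
move=> H; case: (H) => _ H2 _ _.
elim: i' j => [|i' IH] j hi hi'; first by lia.
apply: le_trans (H2 i' j _) _; first by lia.
case: (i =P i') => [->//|ne].
by apply: le_trans (IH j _ _); [apply: gt_row => //; lia | lia | lia].
Qed.

Local Notation trop_toggle := (toggle n k Num.min +%R (@GRing.opp int) 0).

(** For a Gelfand-Tsetlin array, the free cells of row $i$ for the letters $c,c+1$ are the columns
    $d$ with [bk_lo] $\le d<$ [bk_hi]. *)
Definition bk_lo A c i : int :=
  if i == k then A i c.-1 else Num.max (A i c.-1) (A i.+1 c.+1).
Definition bk_hi A c i : int :=
  if i == 1%N then A i c.+1 else Num.min (A i c.+1) (A i.-1 c.-1).

Lemma bk_bounds A c i : gt_array A -> (0 < c)%N -> (1 <= i <= k)%N ->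
  bk_lo A c i <= A i c <= bk_hi A c i.
Proof.
move=> H hc hi; case: (H) => H1 H2 H3 H4.
have h1 := H1 i c hi; have := H1 i c.-1 hi; rewrite prednK // => h0.
apply/andP; split; rewrite /bk_lo /bk_hi; case: eqP => // ne.
  by rewrite ge_max h0 H2 //; lia.
rewrite le_min h1 /=; have := H2 i.-1 c.-1; rewrite !prednK //; [apply; lia|lia].
Qed.

(** Since a minimum of negatives is minus a maximum, the tropical toggle reflects $A_{ic}$ in its
    interval. Outside $R_k$ the interval is a single point, so the formula persists there. *)
Lemma toggle_same A c i : gt_array A -> (1 <= c < n)%N -> (1 <= i <= k)%N ->
  trop_toggle c A i c = bk_lo A c i + bk_hi A c i - A i c.
Proof.
move=> H hc hi; have bnd := bk_bounds H (c := c) (i := i) (ltac:(lia)) hi.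
have up0 : bk_hi A c i <= L%:Z.
  rewrite /bk_hi; case: eqP => _; first exact: gt_leL.
  by rewrite ge_min gt_leL.
have lo0 : 0 <= bk_lo A c i.
  rewrite /bk_lo; case: eqP => _; first exact: gt_ge0.
  by rewrite le_max gt_ge0.
case: (H) => H1 H2 H3 H4.
rewrite /toggle eqxx /=; case: ifP => hR; last first.
  have : (c < i)%N || (i + (n - k) <= c)%N by move: hR; rewrite /in_R; lia.
  case/orP => hci.
    suff -> : bk_hi A c i = 0 by have := H3 i c hi hci; lia.
    have {}bnd : A i c <= bk_hi A c i by case/andP: bnd.
    apply: le_anti; rewrite -{2}(H3 i c hi hci) bnd andbT /bk_hi.
    case: eqP; first by lia.
    by move=> _; rewrite ge_min (H3 i.-1) ?lexx ?orbT //; lia.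
  suff -> : bk_lo A c i = L%:Z by have := H4 i c hi hci; lia.
  apply: le_anti; rewrite -{1}(H4 i c hi hci); case/andP: bnd => -> _ /=.
  rewrite /bk_lo; case: eqP; first by lia.
  by move=> _; rewrite le_max (H4 i.+1) ?lexx ?orbT //; lia.
(* On the right edge [tog_up] agrees with the minimum because $A_{i,c+1}=L$ bounds every entry; on
   the diagonal, $A_{i,c-1}=0$ does the same for [tog_low]. *)
have -> : tog_up n k Num.min A A i c = bk_hi A c i.
  rewrite /tog_up /bk_hi; case: eqP => // i1; case: eqP => ci; last by rewrite minC.
  by rewrite (H4 i c.+1) ?ci // min_r // gt_leL //; lia.
have -> : tog_low k Num.min (@GRing.opp int) 0 A A i c = - bk_lo A c i.
  rewrite /tog_low /bk_lo; case: eqP => ci; case: eqP => ik //.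
  - by rewrite H3 ?oppr0 //; lia.
  - rewrite (H3 i c.-1) //; last by lia.
    by rewrite max_r // gt_ge0 //; lia.
  - by rewrite oppr_max.
by lia.
Qed.

(** Reflection keeps $A_{ic}$ in its interval, whose ends come from the entries of columns $c-1$ and
    $c+1$ that bound it; the toggle fixes those. *)
Lemma toggle_gt A c : gt_array A -> (1 <= c < n)%N -> gt_array (trop_toggle c A).
Proof.
move=> H hc; case: (H) => H1 H2 H3 H4.
have E := toggle_same H hc.
have out i j : j != c -> trop_toggle c A i j = A i j.
  by rewrite /toggle => /negbTE->.
have B i (hi : (1 <= i <= k)%N) := bk_bounds (c := c) H (ltac:(lia)) hi.
split=> [i j hi|i j hi|i j hi hij|i j hi hij].
- have b := B i hi.
  have lo : A i c.-1 <= bk_lo A c i by rewrite /bk_lo; case: eqP => _; rewrite ?le_max lexx.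
  have up : bk_hi A c i <= A i c.+1 by rewrite /bk_hi; case: eqP => _; rewrite ?ge_min lexx.
  case: (j =P c) => [->|jc]; first by rewrite E // out; [lia | lia].
  case: (j.+1 =P c) => [jc'|jc']; last by rewrite !out ?H1 //; exact/eqP.
  have jE : j = c.-1 by lia.
  by rewrite jc' E // jE out; lia.
- have hi' : (1 <= i <= k)%N by lia.
  have hi1 : (1 <= i.+1 <= k)%N by lia.
  have b := B i hi'; have b1 := B i.+1 hi1.
  have lo : A i.+1 c.+1 <= bk_lo A c i.
    by rewrite /bk_lo; case: eqP; [lia | move=> _; rewrite le_max lexx orbT].
  have up : bk_hi A c i.+1 <= A i c.-1.
    by rewrite /bk_hi; case: eqP; [lia | move=> _; rewrite ge_min lexx orbT].
  case: (j =P c) => [->|jc]; first by rewrite [X in _ <= X]E // out; [lia | lia].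
  case: (j.+1 =P c) => [jc'|jc']; last by rewrite !out ?H2 //; exact/eqP.
  have jE : j = c.-1 by lia.
  by rewrite jc' E // jE out; lia.
- by rewrite /toggle ifF ?H3 // /in_R; lia.
- by rewrite /toggle ifF ?H4 // /in_R; lia.
Qed.

(** Let the free cells of a row be $M\le d<N$. Cell $d$ has $d-M$ free cells before it and
    $N-A_{ic}$ of them carry $c+1$, so it receives $c$ exactly when $d<M+N-A_{ic}$, the reflected
    value. *)
Lemma bk_represents T A c : gt_array A -> (1 <= c < n)%N -> represents T A ->
  represents (bender_knuth c T) (trop_toggle c A).
Proof.
move=> H hc HT; case: (H) => H1 H2 H3 H4.
have TE (i : 'I_k) d j : (0 < j)%N -> (T i d == j) = (A i.+1 j.-1 <= d%:Z < A i.+1 j).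
  move=> hj; have := HT i d j; have := HT i d j.-1; lia.
have lo (i : 'I_k) d : free_lo c T i d = (bk_lo A c i.+1 <= d%:Z < A i.+1 c).
  rewrite /free_lo TE /bk_lo; last by lia.
  case: eqP => ik.
    case: existsP => [[i' /andP[/eqP hi' _]]|_]; last by rewrite andbT.
    by have := ltn_ord i'; lia.
  have hi' : (i.+1 < k)%N by have := ltn_ord i; lia.
  have -> : [exists i' : 'I_k, (i' == i.+1 :> nat) && (T i' d == c.+1)] =
            (A i.+2 c <= d%:Z < A i.+2 c.+1).
    have := TE (Ordinal hi') d c.+1 isT; rewrite /= => <-; apply/existsP/idP => [[i' /andP[/eqP e]]|e].
      by have -> : i' = Ordinal hi' by apply/val_inj.
    by exists (Ordinal hi'); rewrite eqxx.
  have := H2 i.+1 c.-1; rewrite prednK; last by lia.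
  move=> /(_ (ltac:(lia))); rewrite ge_max; lia.
have hi (i : 'I_k) d : free_hi c T i d = (A i.+1 c <= d%:Z < bk_hi A c i.+1).
  rewrite /free_hi TE /bk_hi //=.
  case: eqP => ik.
    case: existsP => [[i' /andP[/eqP hi' _]]|_]; last by rewrite andbT.
    by lia.
  have hi' : (i.-1 < k)%N by have := ltn_ord i; lia.
  have -> : [exists i' : 'I_k, (i == i'.+1 :> nat) && (T i' d == c)] =
            (A i c.-1 <= d%:Z < A i c).
    have iE : i = i.-1.+1 :> nat by lia.
    have := TE (Ordinal hi') d c; rewrite /= -iE => <-; last by lia.
    apply/existsP/idP => [[i' /andP[/eqP e]]|e].
      by have -> : i' = Ordinal hi' by apply/val_inj => /=; lia.
    by exists (Ordinal hi'); rewrite /= -iE eqxx.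
  have := H2 i c; have := ltn_ord i => ? /(_ (ltac:(lia))); rewrite lt_min; lia.
move=> i d j.
have hi1 : (1 <= i.+1 <= k)%N by have := ltn_ord i; lia.
have b := bk_bounds (c := c) H (ltac:(lia)) hi1.
have lo0 : 0 <= bk_lo A c i.+1.
  by rewrite /bk_lo; case: eqP => _; rewrite ?le_max gt_ge0.
have upL : bk_hi A c i.+1 <= L%:Z.
  by rewrite /bk_hi; case: eqP => _; rewrite ?ge_min gt_leL.
have loA : A i.+1 c.-1 <= bk_lo A c i.+1.
  by rewrite /bk_lo; case: eqP => _; rewrite ?le_max lexx.
have upA : bk_hi A c i.+1 <= A i.+1 c.+1.
  by rewrite /bk_hi; case: eqP => _; rewrite ?ge_min lexx.
have E := toggle_same H hc hi1.
have out : j != c -> trop_toggle c A i.+1 j = A i.+1 j.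
  by rewrite /toggle => /negbTE->.
have fr d' : free_lo c T i d' || free_hi c T i d' =
    (bk_lo A c i.+1 <= d'%:Z < bk_hi A c i.+1) by rewrite lo hi; lia.
rewrite /bender_knuth mxE fr.
case: ifP => hfr; last first.
  (* A cell that is not free lies outside the interval, where $A_{ic}$ and its reflection compare
     with $d$ in the same way. *)
  case: (j =P c) => [->|/eqP jc]; last by rewrite out.
  by rewrite E HT; lia.
have fh := hi i; move: lo0 upL b loA upA hfr E fr fh.
case: (bk_lo A c i.+1) => // M _.
case: (bk_hi A c i.+1) => [N|N]; last by lia.
case EA : (A i.+1 c) => [Ac|Ac]; last by lia.
move=> upL b loA upA hfr E fr fh.
have -> : #|[set d0 : 'I_L | (d0 < d)%N && (free_lo c T i d0 || free_hi c T i d0)]|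
         = (d - M)%N.
  rewrite -(card_ord_itv (L := L) M) ?(ltnW (ltn_ord d)) //.
  by apply: eq_card => d0; rewrite !inE fr; lia.
have -> : #|[set d0 | free_hi c T i d0]| = (N - Ac)%N.
  rewrite -(card_ord_itv (L := L)) ?lez_nat //.
  by apply: eq_card => d0; rewrite !inE fh; lia.
case: (ltngtP j c) => jc.
- rewrite out; last by lia.
  have := gt_row (j := j) (j' := c.-1) H hi1; case: ifP => _; lia.
- rewrite out; last by lia.
  have := gt_row (j := c.+1) (j' := j) H hi1; case: ifP => _; lia.
- by rewrite jc E; case: ifP; lia.
Qed.

End GT.

Notation trop_prom n k := (prom n k Num.min +%R (@GRing.opp int) 0).

(** * Tableaux and rectangles *)

Section Tableaux.
Variables (n k L : nat).
Hypothesis hk : (0 < k < n)%N.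
Implicit Types (A : nat -> nat -> int) (T : 'M[nat]_(k, L)).

Lemma promotion_represents T A : gt_array n k L A -> represents T A ->
  gt_array n k L (trop_prom n k A) /\ represents (promotion n T) (trop_prom n k A).
Proof.
move=> H HT; rewrite /promotion /prom.
have : all (fun c => 1 <= c < n)%N (iota 1 n.-1).
  by apply/allP => c; rewrite mem_iota; lia.
elim: (iota 1 n.-1) => [|c s IH] //= /andP[hc hs].
have [G RT] := IH hs.
by split; [exact: toggle_gt | exact: bk_represents].
Qed.

Lemma rect_of_tab_represents T A ij : gt_array n k L A -> represents T A ->
  rect_of_tab T (Some ij : coords n k) = A (val ij).1 (val ij).2.
Proof.
move=> H HT; rewrite /rect_of_tab; have : in_R n k (val ij).1 (val ij).2.
  by rewrite -mem_Rset -surjective_pairing; case: (ij).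
move: (val ij) => -[i j] /= hij.
have hi : (i.-1 < k)%N by move: hij; rewrite /in_R; lia.
have iE : i.-1.+1 = i by move: hij; rewrite /in_R; lia.
have hi1 : (1 <= i <= k)%N by lia.
rewrite (big_pred1 (Ordinal hi)); last first.
  by move=> a /=; rewrite -val_eqE /= -{1}iE eqSS.
have Ti c : (T (Ordinal hi) c <= j)%N = (c%:Z < A i j) by rewrite HT /= iE.
move: (gt_ge0 hk j H hi1) (gt_leL j H hi1) Ti; case: (A i j) => // a _ aL Ti.
have -> : [set c | (T (Ordinal hi) c <= j)%N] = [set c : 'I_L | (0 <= c < a)%N].
  by apply/setP => c; rewrite !inE Ti.
by rewrite card_ord_itv // subn0.
Qed.

Lemma represents_ssyt T A : gt_array n k L A -> represents T A -> ssyt n T.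
Proof.
move=> H HT; case: (H) => H1 H2 H3 H4.
have hi (i : 'I_k) : (1 <= i.+1 <= k)%N by rewrite ltn_ord.
split=> [i c|i c c' cc'|i i' c ii'].
- have e0 := H3 i.+1 0%N (hi i) isT.
  have en : A i.+1 n = L%:Z by apply: H4; [exact: hi | have := ltn_ord i; lia].
  by rewrite ltnNge !HT e0 en ltz_nat ltn_ord.
- have := leqnn (T i c'); rewrite HT => h; rewrite HT; lia.
- have := leqnn (T i' c); rewrite HT.
  case ET : (T i' c) => [|j]; first by rewrite (H3 _ _ (hi i')).
  move=> h; rewrite ltnS HT; apply: lt_le_trans h _.
  by apply: gt_col H _ _; have := ltn_ord i'; lia.
Qed.

Lemma represents_exists A : gt_array n k L A -> exists T, represents T A.
Proof.
move=> H; case: (H) => H1 H2 H3 H4.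
have ex (i : 'I_k) (c : 'I_L) : exists j, c%:Z < A i.+1 j.
  exists (i.+1 + (n - k))%N; rewrite H4 ?leqnn ?ltz_nat ?ltn_ord //.
exists (\matrix_(i, c) ex_minn (ex i c)) => i c j; rewrite mxE.
case: ex_minnP => m hm mm; apply/idP/idP => [mj|]; last exact: mm.
by apply: lt_le_trans hm _; apply: gt_row H _ mj; rewrite /= ltn_ord.
Qed.

(** [rect_of_tab] records counts inside $R_k$ only. Outside, strict columns force $i+1\le T_{ic}\le
    n-(k-1-i)$, rows being numbered from $0$, which yields the values $0$ and $L$. *)
Lemma ssyt_represents T (b : coords n k -> int) :
  gt_array n k L (array b) -> ssyt n T -> rect_of_tab T = b ->
  represents T (array b).
Proof.
move=> H [S1 S2 S3] Tb i c j; case: (H) => _ _ H3 H4.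
have hi := ltn_ord i.
have lowT (a : nat) (ha : (a < k)%N) : (a < T (Ordinal ha) c)%N.
  elim: a ha => [|a IH] ha; first by case/andP: (S1 (Ordinal ha) c).
  have ha' : (a < k)%N by lia.
  by have := IH ha'; have := S3 (Ordinal ha') (Ordinal ha) c (ltnSn _); lia.
have upT (a : nat) (ha : (k.-1 - a < k)%N) : (a < k)%N -> (T (Ordinal ha) c + a <= n)%N.
  elim: a ha => [|a IH] ha hak; first by case/andP: (S1 (Ordinal ha) c); lia.
  have ha' : (k.-1 - a < k)%N by lia.
  have := IH ha' (ltac:(lia)).
  have := S3 (Ordinal ha) (Ordinal ha') c; rewrite /= => /(_ (ltac:(lia))); lia.
case: (boolP (in_R n k i.+1 j)) => hij; last first.
  have : (j < i.+1)%N || (i.+1 + (n - k) <= j)%N by move: hij; rewrite /in_R; lia.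
  case/orP => hj.
    rewrite H3 //; have := lowT i hi.
    by have -> : Ordinal hi = i by [apply/val_inj]; lia.
  rewrite H4 //; have hi' : (k.-1 - (k.-1 - i) < k)%N by lia.
  have := upT (k.-1 - i)%N hi' (ltac:(lia)); have -> : Ordinal hi' = i by apply/val_inj => /=; lia.
  by have := ltn_ord c; lia.
have hR : (i.+1, j) \in Rset n k by rewrite mem_Rset.
rewrite (array_in b hR) -Tb /rect_of_tab /= (big_pred1 i); last first.
  by move=> a; rewrite /= eqSS.
rewrite ltz_nat -downset_card ?inE // => d d' dd'; rewrite !inE.
by apply: leq_trans; apply: S2.
Qed.

End Tableaux.

Section Rectangles.
Variables (n k : nat) (b : coords n k -> int).
Hypothesis hk : (0 < k < n)%N.
Hypothesis hb : k_rectangle b.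

(** $L$ is the array entry $A_{kn}$. *)
Lemma k_rectangle_ge0 : 0 <= b None.
Proof.
case: hb => h _; have := h k n; rewrite array_out; last by rewrite /in_R; lia.
have -> : (k + (n - k) <= n)%N by lia.
by apply; lia.
Qed.

Lemma k_rectangle_gt : gt_array n k `|b None| (array b).
Proof.
have L0 := k_rectangle_ge0; case: hb => b0 bm.
have z i j : (1 <= i <= k)%N -> (j < i)%N -> array b i j = 0.
  move=> hi hj; rewrite array_out; last by rewrite /in_R; lia.
  by have -> : (i + (n - k) <= j)%N = false by lia.
have l i j : (1 <= i <= k)%N -> (i + (n - k) <= j)%N -> array b i j = `|b None|%:Z.
  move=> hi hj; rewrite array_out; last by rewrite /in_R; lia.
  by rewrite hj gez0_abs.
split=> // i j hi.
- case: (ltnP j i) => ji.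
    rewrite (z i j) //; case: (ltnP j.+1 i) => ji'; first by rewrite z.
    by apply: b0; lia.
  case: (ltnP j n) => jn; last by rewrite !l //; lia.
  by have /andP[] := bm i j (ltac:(lia)) (ltac:(lia)).
- case: (ltnP j i) => ji; first by rewrite !z //; lia.
  case: (ltnP j n) => jn; last by rewrite !l //; lia.
  by have /andP[] := bm i j (ltac:(lia)) (ltac:(lia)).
Qed.

(** A tableau for [b] exists, and whichever one [xget] picks represents the array, so promotion can
    be followed on patterns. *)
Lemma pr_rectE v :
  pr_rect b v = if v is Some ij then trop_prom n k (array b) (val ij).1 (val ij).2
                else b None.
Proof.
have G := k_rectangle_gt.
have [T0 HT0] := represents_exists G.
have ok0 : [set T | ssyt n T /\ rect_of_tab T = b]%classic T0.
  split; first exact: represents_ssyt HT0.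
  apply: funext => -[ij|]; last by rewrite /= gez0_abs ?k_rectangle_ge0.
  by rewrite (rect_of_tab_represents hk ij G HT0) array_Some.
have HT : represents (tab_of_rect b) (array b).
  rewrite /tab_of_rect; case: xgetP => [T _ [T1 T2]|/(_ _ ok0)//].
  exact: ssyt_represents.
have [G' HT'] := promotion_represents hk G HT.
rewrite /pr_rect; case: v => [ij|]; last by rewrite /= gez0_abs ?k_rectangle_ge0.
exact: rect_of_tab_represents.
Qed.

End Rectangles.

(** * Geometric promotion *)

Section Main.
Variables (C : numFieldType) (n k : nat).
Hypothesis hk : (0 < k < n)%N.

Let X0 : nat -> nat -> ratfun C n k := array (coord_fun C (n := n) (m := k)).
Let P := prom n k +%R *%R GRing.inv 1 X0.

Definition geom_prom (v : coords n k) : ratfun C n k :=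
  if v is Some ij then P (val ij).1 (val ij).2 else coord_fun C None.

Lemma geom_promE i j : tog_dom n k i j -> array geom_prom i j = P i j.
Proof.
case/orP => [h|/andP[/eqP-> /eqP->]].
  by move: (h); rewrite -mem_Rset => h'; rewrite (array_in _ h').
by rewrite array_t /P prom_out ?/X0 ?array_t // /in_R; lia.
Qed.

Lemma trop_val_X0 b i j : tog_dom n k i j -> trop_val b (X0 i j) (array b i j).
Proof.
rewrite /X0 => h; case/orP: (h) => [|/andP[/eqP-> /eqP->]].
  by rewrite -mem_Rset => h'; rewrite !(array_in _ h'); exact: trop_val_coord.
by rewrite !array_t; exact: trop_val_coord.
Qed.

Lemma trop_val_P b i j : tog_dom n k i j ->
  trop_val b (P i j) (trop_prom n k (array b) i j).
Proof.
apply: (prom_rel (Rel := trop_val b)).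
- exact: trop_valD.
- exact: trop_valM.
- exact: trop_valV.
- exact: trop_val1.
- exact: trop_val_X0.
Qed.

Lemma trop_val_geom_prom b v : trop_val b (geom_prom v)
  (if v is Some ij then trop_prom n k (array b) (val ij).1 (val ij).2 else b None).
Proof.
case: v => [ij|]; last exact: trop_val_coord.
apply: trop_val_P; rewrite /tog_dom -mem_Rset -surjective_pairing.
by case: (ij) => /= s ->.
Qed.

Lemma geom_prom_rel i j : in_R n k i j ->
  P i j * (X0 i j * tog_low k +%R GRing.inv 1 X0 P i j) = tog_up n k +%R X0 P i j.
Proof.
move=> hij; have dij : tog_dom n k i j by rewrite /tog_dom hij.
rewrite {1}/P prom_eq //; last by lia.
(* The denominator is nonzero because it is built without subtraction; a tropical value at any
   point, here $b=0$, certifies this. *)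
rewrite divfK //; pose b : coords n k -> int := fun=> 0.
apply: (@trop_val_neq0 _ _ _ b); apply: trop_valM; first exact: trop_val_X0.
apply: (tog_low_rel (Rel := trop_val b)) hij => [||i' j' h|i' j' h].
- exact: trop_valD.
- exact: trop_val1.
- exact/trop_valV/trop_val_X0.
- exact/trop_valV/trop_val_P.
Qed.

Lemma geom_prom_rational :
  is_rational_map (fun x : coords n k -> C => Theta_inv (PR (n - k) (Theta x)))
    geom_prom.
Proof.
have [|h h0 hh] := @generic_values C n k [seq geom_prom v | v : coords n k].
  by move=> f /mapP[v _ ->]; exact: trop_val_frac (trop_val_geom_prom (fun=> 0) v).
exists h => // x tx hx.
have /choice[y hy] : forall v, exists a, a != 0 /\ has_value (geom_prom v) x a.
  move=> v; have [|a a0 ha] := hh x hx (geom_prom v); last by exists a.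
  by apply: map_f; rewrite mem_enum.
have ty : torus y by move=> v; case: (hy v).
have vy v : has_value (geom_prom v) x (y v) by case: (hy v).
exists y => //.
have VX i j : tog_dom n k i j -> has_value (X0 i j) x (array x i j) /\ array x i j != 0.
  rewrite /X0; case/orP => [|/andP[/eqP-> /eqP->]].
    rewrite -mem_Rset => h'; rewrite !(array_in _ h').
    by split; [exact: has_value_coord | exact: tx].
  by rewrite !array_t; split; [exact: has_value_coord | exact: tx].
have VY i j : tog_dom n k i j -> has_value (P i j) x (array y i j) /\ array y i j != 0.
  move=> hij; rewrite -geom_promE //; case/orP: hij => [|/andP[/eqP-> /eqP->]].
    by rewrite -mem_Rset => h'; rewrite !(array_in _ h').
  by rewrite !array_t.
have yx : y None = x None by exact: has_value_uniq (vy None) (has_value_coord None x).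
have yE : Theta y = PR (n - k) (Theta x).
  apply: Theta_prom => // i j hij.
  have dij : tog_dom n k i j by rewrite /tog_dom hij.
  (* Both sides are values at [x] of the one rational function in [geom_prom_rel]. *)
  apply: (@has_value_uniq _ _ _ (P i j * (X0 i j * tog_low k +%R GRing.inv 1 X0 P i j)) x).
    apply: has_valueM; first by case: (VY i j dij).
    apply: has_valueM; first by case: (VX i j dij).
    apply: (tog_low_rel (Rel := fun f a => has_value f x a)) hij => [f g a c||i' j' h'|i' j' h'].
    - exact: has_valueD.
    - exact: has_value1.
    - by have [? ?] := VX i' j' h'; apply: has_valueV.
    - by have [? ?] := VY i' j' h'; apply: has_valueV.
  rewrite geom_prom_rel //.
  apply: (tog_up_rel (Rel := fun f a => has_value f x a)) hij => [f g a c|i' j' h'|i' j' h'].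
  - exact: has_valueD.
  - by case: (VX i' j' h').
  - by case: (VY i' j' h').
apply/seteqP; split=> z /=; last by move=> ->.
by case=> tz zE; apply: (Theta_inj hk tz ty); rewrite zE.
Qed.

(** Reduces the claims about an arbitrary [F] representing the map to claims about [geom_prom]. *)
Lemma rational_map_uniq phi (F G : coords n k -> ratfun C n k) :
  is_rational_map phi F -> is_rational_map phi G -> (forall v, is_frac (G v)) -> F = G.
Proof.
move=> [h h0 hF] [g g0 hG] fG; apply: funext => v.
apply: (ratfun_eq (fG v) (mulf_neq0 h0 g0)) => x tx.
rewrite pevalM mulf_eq0 negb_or => /andP[hx gx].
have [y Fy ey] := hF x tx hx; have [z Gz ez] := hG x tx gx.
have yz : y = z by have : [set z]%classic y by rewrite -ez ey.
by exists (y v); rewrite // yz.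
Qed.

Lemma conj_PR_promotion (F : coords n k -> ratfun C n k) :
  is_rational_map (fun x : coords n k -> C => Theta_inv (PR (n - k) (Theta x))) F ->
  (forall v, subtraction_free (F v)) /\
  (forall b : coords n k -> int, k_rectangle b -> (fun v => Trop (F v) b) = pr_rect b).
Proof.
move=> hF; have -> : F = geom_prom.
  apply: rational_map_uniq hF geom_prom_rational _ => v.
  exact: trop_val_frac (trop_val_geom_prom (fun=> 0) v).
split=> [v|b hb]; first exact: trop_val_sf (trop_val_geom_prom (fun=> 0) v).
apply: funext => v; rewrite pr_rectE //.
exact: TropE (trop_val_geom_prom b v).
Qed.

End Main.

Theorem theorem5p4 (R : realType) (n k : nat)
    (hn : (2 <= n)%N) (hk : (1 <= k <= n.-1)%N) :
  let conj_PR (x : coords n k -> R[i]) : set (coords n k -> R[i]) :=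
    Theta_inv (PR (n - k) (Theta x)) in
  (exists F : coords n k -> ratfun R[i] n k, is_rational_map conj_PR F) /\
  (forall F : coords n k -> ratfun R[i] n k, is_rational_map conj_PR F ->
     (forall v, subtraction_free (F v)) /\
     (forall b : coords n k -> int, k_rectangle b ->
        (fun v => Trop (F v) b) = pr_rect b)).
Proof.
have hk' : (0 < k < n)%N by lia.
split; last exact: (@conj_PR_promotion R[i] n k hk').
by exists (@geom_prom R[i] n k); exact: geom_prom_rational.
Qed.
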